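(* Let $B\geqslant 2$ be a real constant and let $q>2$ be a prime power. Let $\xi:\mathbb{N}\to\mathbb{R}$ be a function with $\xi(n)\to\infty$ (however slowly) as $n\to\infty$. Then, uniformly for integers $k$ with $\xi(n)\log n\leqslant k\leqslant n/B$, $$N(n,k)\sim C(q)\,\frac{q^n k^{q-1}(n-k)^{q-1}}{q^k}\qquad (n\to\infty),$$ where $$C(q)=\frac{1}{((q-1)!)^2}\left(1-\frac1q\right)^{q^2}\prod_{p\in\mathcal{P}_{\geqslant 2}}\left(1-\frac{1}{q^{\deg(p)-1}}\right)^{-1}\left(1-\frac{1}{q^{\deg(p)}}\right)^{q}$$ is a constant depending only on $q$.
   Context: $\mathbb{F}_q$ is the finite field with $q$ elements; $q$ is fixed. $\mathcal{M}_n$ is the set of monic polynomials of degree $n$ in $\mathbb{F}_q[t]$. For $f\in\mathbb{F}_q[t]$ nonzero, $\Omega(f)$ is the number of monic irreducible polynomials dividing $f$, counted with multiplicity. $N(n,k)=\#\{f\in\mathcal{M}_n:\Omega(f)=k\}$. $\mathcal{P}_{\geqslant 2}$ is the set of monic irreducible polynomials in $\mathbb{F}_q[t]$ of degree at least $2$. ''However slowly'' means that $\xi$ may be any function tending to infinity, subject to growing slowly enough that the interval $[\xi(n)\log n,\,n/B]$ contains at least one integer for all sufficiently large $n$. ''Uniformly'' means that the supremum, over integers $k$ in $[\xi(n)\log n,\,n/B]$, of the absolute value of (ratio of the two sides minus $1$) tends to $0$ as $n\to\infty$. *)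

(* Defs.v *)
From mathcomp Require Import all_boot all_order all_algebra.
From mathcomp Require Import finmap.
From mathcomp Require Import all_classical all_reals all_analysis.
From mathcomp Require Import showcase.summability.

Set Implicit Arguments.
Unset Strict Implicit.
Unset Printing Implicit Defensive.

Import Order.TTheory GRing.Theory Num.Theory.
Import numFieldNormedType.Exports.

Local Open Scope classical_set_scope.
Local Open Scope ring_scope.

Definition monic_irred (F : finFieldType) (p : {poly F}) : bool :=
  (p \is monic) && `[< irreducible_poly p >].

Definition pdeg (F : finFieldType) (p : {poly F}) : nat := (size p).-1.

(* For [f != 0] and [p] non-constant, [p ^+ e %| f] forces [e < size f], so the
   maximum ranges over all exponents that matter. *)
Definition multiplicity (F : finFieldType) (p f : {poly F}) : nat :=
  \max_(e < size f | p ^+ e %| f) e.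

(* [{poly_m F}] is the finite type of polynomials of size at most [m]; every
   divisor of [f != 0] lives in [{poly_(size f) F}]. *)
Definition Omega (F : finFieldType) (f : {poly F}) : nat :=
  (\sum_(p : {poly_(size f) F} | monic_irred (p : {poly F}))
      multiplicity p f)%N.

Definition N (F : finFieldType) (n k : nat) : nat :=
  #|[set f : {poly_(n.+1) F} |
      [&& (f : {poly F}) \is monic, pdeg f == n & Omega f == k]]%SET|.

Definition in_P_ge2 (F : finFieldType) (p : {poly F}) : bool :=
  monic_irred p && (2 <= pdeg p)%N.

Definition euler_factor (R : realType) (F : finFieldType) (p : {poly F}) : R :=
  let q : R := #|F|%:R in
  (1 - (q ^+ (pdeg p).-1)^-1)^-1 * (1 - (q ^+ pdeg p)^-1) ^+ #|F|.

Definition partial_euler_product (R : realType) (F : finFieldType)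
    (A : {fset {poly F}}) : R :=
  \prod_(p <- A | in_P_ge2 p) euler_factor R p.

(* Unordered infinite product: limit of the finite partial products along the
   filter [totally] of finite sets ordered by inclusion. *)
Definition euler_product (R : realType) (F : finFieldType) : R :=
  lim (partial_euler_product R (F := F) @ totally).

Definition Cq (R : realType) (F : finFieldType) : R :=
  let q : R := #|F|%:R in
  (((#|F|.-1)`!)%:R ^+ 2)^-1 * (1 - q^-1) ^+ (#|F| ^ 2) * euler_product R F.

Definition main_term (R : realType) (F : finFieldType) (n k : nat) : R :=
  let q : R := #|F|%:R in
  Cq R F * (q ^+ n * k%:R ^+ (#|F|.-1) * (n%:R - k%:R) ^+ (#|F|.-1) / q ^+ k).

Definition k_range (R : realType) (B : R) (xi : nat -> R) (n : nat) : set nat :=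
  [set k : nat | xi n * ln n%:R <= k%:R <= n%:R / B].

(* The set under [sup] is finite; it is nonempty whenever [k_range B xi n] is. *)
Definition max_rel_error (R : realType) (F : finFieldType) (B : R)
    (xi : nat -> R) (n : nat) : R :=
  sup [set `|(N F n k)%:R / main_term R F n k - 1| | k in k_range B xi n].

(* Main.v *)
(* Write f = l g with l a product of linear polynomials and g without linear
   factors.  If g has m prime factors and deg g = (n - k) + m, then l is one of
   C(k - m + q - 1, q - 1) polynomials, hence
     N(n, k) = sum_m C(k - m + q - 1, q - 1) e(n - k, m),
   where e(s, m) counts the g with Omega(g) = m and deg g - Omega(g) = s.

   Let I_d be the number of monic irreducible polynomials of degree d.  The
   totals a_s = sum_m e(s, m) have generating function
     prod_(d >= 1) (1 - u^d)^(-I_(d+1)) = (1 - q u)^(-q) H(u),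
     H(u) = prod_(d >= 1) (1 - u^d)^(q I_d - I_(d+1)),
   and sum_(d | n) d I_d = q^n makes q I_d - I_(d+1) so small that H converges
   absolutely at 1/q.  Summing partially q times gives
   a_s ~ H(1/q) q^s s^(q-1) / (q-1)!, and regrouping the factors turns H(1/q)
   into the Euler product of the theorem.

   Only m = O(log n) matters: sum_m e(s, m) 2^m <= q^s (s + 1)^(6 q), so the mean
   of m is O(log n), which is o(k), and every binomial coefficient may be replaced
   by k^(q-1) / (q-1)!. *)

Require Import Defs.
From mathcomp Require Import all_boot all_order all_algebra.
From mathcomp Require Import finmap.
From mathcomp Require Import all_classical all_reals all_analysis.
From mathcomp Require Import showcase.summability.
From mathcomp Require Import zify ring lra.
From HB Require Import structures.

Import Order.TTheory GRing.Theory Num.Theory.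
Import numFieldNormedType.Exports.
Local Open Scope classical_set_scope.
Local Open Scope ring_scope.

Set Implicit Arguments.
Unset Strict Implicit.

(** * Formal power series *)

(** All series are rescaled by u -> u / q. The zeta function becomes 1 / (1 - u), evaluating H at
    1/q becomes summing its coefficients, and dividing by 1 - u is partial summation, so weighted
    Cesaro means can stand in for singularity analysis. Infinite products enter only through finite
    ones: a given coefficient sees finitely many factors, and convergence is measured in truncated
    l1 norms, against the majorant prod (1 - q^(-d))^(-|q I_d - I_(d+1)|). The crude estimate d I_d
    = q^d + O(q^d / d) already makes the logarithm of that majorant converge.

    The weight 2^m is where q > 2 matters: 1 - 2 u^d must not vanish at u = 1/q. The inequality m <=
    T + 2^(m - T), with T of order log n, turns the bound at weight 2 into one for the mean of m.
    The upper estimate of N(n, k) does not need that mean; only the lower one does, through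
    Bernoulli's inequality. *)

Record fps (A : Type) := Fps { fcoef :> nat -> A }.

HB.instance Definition _ (A : Type) := gen_eqMixin (fps A).
HB.instance Definition _ (A : Type) := gen_choiceMixin (fps A).

Section FpsRing.
Variable A : comNzRingType.
Implicit Types a b c : fps A.

Lemma fpsP a b : (forall n, a n = b n) -> a = b.
Proof. by case: a b => [a] [b] /= /funext ->. Qed.

Definition fps_add a b := Fps (fun n => a n + b n).
Definition fps_opp a := Fps (fun n => - a n).
Definition fps_mul a b := Fps (fun n => \sum_(i < n.+1) a i * b (n - i)%N).
Definition fps_zero : fps A := Fps (fun=> 0).
Definition fps_one : fps A := Fps (fun n => (n == 0%N)%:R).

Definition trunc n a : {poly A} := \poly_(i < n.+1) a i.

(** Below the cut, series multiply like polynomials, so commutativity and associativity are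
    inherited from [{poly A}]. *)
Lemma coef_truncM n i a b : (i <= n)%N -> (trunc n a * trunc n b)`_i = fps_mul a b i.
Proof.
move=> le_in; rewrite coefM; apply: eq_bigr => j _.
by rewrite !coef_poly !ltnS (leq_trans (leq_ord j)) // (leq_trans (leq_subr _ _)).
Qed.

Fact fps_addA : associative fps_add.
Proof. by move=> a b c; apply: fpsP => n; rewrite /= addrA. Qed.
Fact fps_addC : commutative fps_add.
Proof. by move=> a b; apply: fpsP => n; rewrite /= addrC. Qed.
Fact fps_add0 : left_id fps_zero fps_add.
Proof. by move=> a; apply: fpsP => n; rewrite /= add0r. Qed.
Fact fps_addN : left_inverse fps_zero fps_opp fps_add.
Proof. by move=> a; apply: fpsP => n; rewrite /= addNr. Qed.

HB.instance Definition _ :=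
  GRing.isZmodule.Build (fps A) fps_addA fps_addC fps_add0 fps_addN.

Fact fps_mulC : commutative fps_mul.
Proof. by move=> a b; apply: fpsP => n; rewrite -!(coef_truncM _ _ (leqnn n)) mulrC. Qed.

Fact fps_mulA : associative fps_mul.
Proof.
have assoc1 a b c n : fps_mul a (fps_mul b c) n = (trunc n a * (trunc n b * trunc n c))`_n.
  rewrite coefM; apply: eq_bigr => j _.
  by rewrite coef_poly ltnS leq_ord (coef_truncM _ _ (leq_subr _ _)).
move=> a b c; apply: fpsP => n; rewrite assoc1 [RHS](_ : _ = fps_mul c (fps_mul a b) n).
  by rewrite assoc1 mulrA mulrC.
by rewrite (fps_mulC c).
Qed.

Fact fps_mul1 : left_id fps_one fps_mul.
Proof.
move=> a; apply: fpsP => n /=; rewrite big_ord_recl /= subn0 mul1r big1 ?addr0 //.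
by move=> i _; rewrite mul0r.
Qed.

Fact fps_mulD : left_distributive fps_mul fps_add.
Proof.
move=> a b c; apply: fpsP => n /=; rewrite -big_split /=.
by apply: eq_bigr => i _; rewrite mulrDl.
Qed.

Fact fps_oner_neq0 : fps_one != fps_zero.
Proof.
apply/eqP => /(congr1 (fun a : fps A => a 0%N)) /= /eqP.
by rewrite oner_eq0.
Qed.

HB.instance Definition _ := GRing.Zmodule_isComNzRing.Build (fps A)
  fps_mulA fps_mulC fps_mul1 fps_mulD fps_oner_neq0.

Lemma fpsDE a b n : (a + b) n = a n + b n. Proof. by []. Qed.
Lemma fpsNE a n : (- a) n = - a n. Proof. by []. Qed.
Lemma fps1E n : (1 : fps A) n = (n == 0%N)%:R. Proof. by []. Qed.
Lemma fpsME a b n : (a * b) n = \sum_(i < n.+1) a i * b (n - i)%N.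
Proof. by []. Qed.

Lemma fps_sumE I (r : seq I) (P : pred I) (f : I -> fps A) n :
  (\sum_(i <- r | P i) f i) n = \sum_(i <- r | P i) f i n.
Proof. by elim/big_rec2: _ => //= i x y _ <-. Qed.

Lemma fpsMnE a m n : (a *+ m) n = a n *+ m.
Proof. by elim: m => [|m IH] //; rewrite !mulrS fpsDE IH. Qed.

(** Congruence modulo [u^(n+1)], under which an infinite product reduces to the finitely many
    factors that reach a given coefficient. *)
Definition agree n a b := forall i, (i <= n)%N -> a i = b i.

Lemma agreeM n a b a' b' : agree n a a' -> agree n b b' -> agree n (a * b) (a' * b').
Proof.
move=> aa bb i le_in; rewrite !fpsME; apply: eq_bigr => j _.
have le_ji := leq_ord j.
by rewrite aa ?bb // ?(leq_trans (leq_subr _ _)) // (leq_trans le_ji).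
Qed.

Lemma agree_prod n I (r : seq I) (P : pred I) (f g : I -> fps A) :
  (forall i, P i -> agree n (f i) (g i)) ->
  agree n (\prod_(i <- r | P i) f i) (\prod_(i <- r | P i) g i).
Proof. by move=> fg; elim/big_rec2: _ => // i x y Pi; apply: agreeM; apply: fg. Qed.

Lemma agree_prod1 n (I : eqType) (r : seq I) (f : I -> fps A) :
  (forall i, i \in r -> agree n (f i) 1) -> agree n (\prod_(i <- r) f i) 1.
Proof.
move=> f1; rewrite big_seq; elim/big_ind: _ => // a b a1 b1.
by rewrite -[1]mulr1; apply: agreeM.
Qed.

Lemma agreeX n k a b : agree n a b -> agree n (a ^+ k) (b ^+ k).
Proof.
move=> ab; elim: k => [|k IH]; first by rewrite !expr0.
by rewrite !exprS; apply: agreeM.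
Qed.

Definition mono (x : A) (d : nat) : fps A := Fps (fun n => if n == d then x else 0).

Lemma monoM x y d e : mono x d * mono y e = mono (x * y) (d + e).
Proof.
apply: fpsP => n; rewrite fpsME /=.
case: (ltnP n d) => ltnd.
  rewrite big1 ?ifN // => [|i _]; first by apply/eqP => nE; move: ltnd; lia.
  by rewrite ifN ?mul0r //; apply/eqP => iE; have := leq_ord i; lia.
rewrite (bigD1 (inord d)) //= big1 ?addr0 => [|i]; last first.
  rewrite -val_eqE /= inordK ?ltnS // => /negbTE ->; exact: mul0r.
rewrite inordK ?ltnS // eqxx; case: eqP => nd; case: eqP => nde; try lia; last exact: mulr0.
by [].
Qed.

Lemma mono10 : mono 1 0 = 1.
Proof. by apply: fpsP => n; rewrite fps1E /=; case: (n == 0%N). Qed.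

Lemma mono_prod I (r : seq I) (x : I -> A) (d : I -> nat) :
  \prod_(i <- r) mono (x i) (d i) = mono (\prod_(i <- r) x i) (\sum_(i <- r) d i)%N.
Proof.
elim: r => [|i r IH]; first by rewrite !big_nil mono10.
by rewrite !big_cons IH monoM.
Qed.

(* The expansion of [1 / (1 - x u^d)], for [d > 0]. *)
Definition geo (x : A) (d : nat) : fps A :=
  Fps (fun n => if (d %| n)%N then x ^+ (n %/ d)%N else 0).

Lemma geo0 x d : geo x d 0%N = 1.
Proof. by rewrite /= dvdn0 div0n expr0. Qed.

Lemma monoM_coef x d a n : (mono x d * a) n = if (d <= n)%N then x * a (n - d)%N else 0.
Proof.
rewrite fpsME /=; case: leqP => dn.
  rewrite (bigD1 (inord d)) //= inordK ?ltnS // eqxx big1 ?addr0 // => i.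
  by rewrite -val_eqE /= inordK ?ltnS // => /negbTE ->; rewrite mul0r.
rewrite big1 // => i _; rewrite ifN ?mul0r //.
by have := leq_ord i; lia.
Qed.

Lemma geoE x d : (0 < d)%N -> geo x d = 1 + mono x d * geo x d.
Proof.
move=> d_gt0; apply: fpsP => n; rewrite fpsDE monoM_coef fps1E.
case: leqP => [dn|nd].
  have -> : (n == 0%N) = false by lia.
  rewrite add0r /= -{1 2}(subnK dn) dvdn_addl // divnDr // divnn d_gt0 addn1.
  by case: ifP => _; rewrite ?exprS ?mulr0.
rewrite addr0; case: (posnP n) => [->|n_gt0]; first exact: geo0.
by rewrite /= gtnNdvd // gtn_eqF.
Qed.

Lemma geoK x d : (0 < d)%N -> (1 - mono x d) * geo x d = 1.
Proof. by move=> d_gt0; rewrite mulrBl mul1r {1}geoE // addrK. Qed.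

Lemma geo_agree1 x d n : (n < d)%N -> agree n (geo x d) 1.
Proof.
move=> nd i le_in; rewrite fps1E; case: (posnP i) => [->|i_gt0]; first exact: geo0.
by rewrite /= gtnNdvd ?gtn_eqF //; lia.
Qed.

Lemma mono_agree1 x d n : (n < d)%N -> agree n (1 - mono x d) 1.
Proof.
move=> nd i le_in; rewrite fpsDE fpsNE /= ifN ?subr0 //; lia.
Qed.

Lemma geo_sum_agree x d n M : (0 < d)%N -> (n <= M)%N ->
  agree n (geo x d) (\sum_(j < M.+1) mono (x ^+ j) (j * d)).
Proof.
move=> d_gt0 le_nM i le_in; rewrite fps_sumE /=.
case: ifP => [/dvdnP [j ij]|dvi].
  have ltj : (j < M.+1)%N by nia.
  rewrite (bigD1 (Ordinal ltj)) //= ij mulnK // eqxx big1 ?addr0 // => k.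
  rewrite -val_eqE /= => kj; rewrite ifN //; apply: contra kj => /eqP/eqP.
  by rewrite eqn_pmul2r // eq_sym.
rewrite big1 // => j _; rewrite ifN //; apply/eqP => ij.
by rewrite ij dvdn_mull in dvi.
Qed.

(** Distributing the product over the geometric series produces exponent vectors. Entries up to [M]
    suffice: as [d i > 0], each [v i] is at most [n]. *)
Lemma prod_geo_coef (I : finType) (x : I -> A) (d : I -> nat) n M :
  (forall i, 0 < d i)%N -> (n <= M)%N ->
  (\prod_i geo (x i) (d i)) n =
  \sum_(v : {ffun I -> 'I_M.+1} | (\sum_i v i * d i)%N == n) \prod_i x i ^+ v i.
Proof.
move=> d_gt0 le_nM.
rewrite (agree_prod (g := fun i => \sum_(j < M.+1) mono (x i ^+ j) (j * d i)) _ _ (leqnn n));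
  last by move=> i _; apply: geo_sum_agree.
rewrite bigA_distr_bigA fps_sumE /= [RHS]big_mkcond /=; apply: eq_bigr => v _.
by rewrite mono_prod /= eq_sym.
Qed.

(* The derivation [u d/du]. *)
Definition theta a := Fps (fun n => a n *+ n).

Lemma thetaM a b : theta (a * b) = theta a * b + a * theta b.
Proof.
apply: fpsP => n; rewrite fpsDE !fpsME /= -sumrMnl -big_split /=.
apply: eq_bigr => i _; rewrite mulrnAl mulrnAr -mulrnDr subnKC //; exact: leq_ord.
Qed.

Lemma theta1 : theta 1 = 0.
Proof. by apply: fpsP => n; rewrite /= mulrb; case: n => [|n] //=; rewrite mul0rn. Qed.

Lemma theta_geo x d : (0 < d)%N -> theta (geo x d) = geo x d * ((geo x d - 1) *+ d).
Proof.
move=> d_gt0; have dg := geoE x d_gt0.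
have tm : theta (mono x d) = mono x d *+ d.
  apply: fpsP => n /=.
  by rewrite fpsMnE /=; case: eqP => [->|_] //; rewrite !mul0rn.
have tD : theta (1 - mono x d) = - (mono x d *+ d).
  rewrite -tm; apply: fpsP => n; rewrite fpsNE /= mulrnBl mulrb.
  by case: n => [|n] //=; rewrite ?mulr0n ?mul0rn ?sub0r ?subr0.
have := congr1 theta (geoK x d_gt0).
rewrite thetaM theta1 tD => /(congr1 (fun t => geo x d * t)).
rewrite mulr0 mulrDr (mulrA (geo x d) (1 - _)) (mulrC (geo x d) (1 - _)) geoK // mul1r.
have -> : geo x d - 1 = mono x d * geo x d by rewrite {1}dg addrC addKr.
move/eqP; rewrite addrC addr_eq0 => /eqP ->.
by rewrite mulNr mulrN opprK mulrnAl.
Qed.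

(** [l] plays the role of [theta a / a]; the product form needs no inverse of [a]. *)
Definition logder a l := theta a = a * l.

Lemma logderM a b l l' : logder a l -> logder b l' -> logder (a * b) (l + l').
Proof. by rewrite /logder thetaM => -> ->; ring. Qed.

Lemma logder1 : logder 1 0.
Proof. by rewrite /logder theta1 mulr0. Qed.

Lemma logderX a l k : logder a l -> logder (a ^+ k) (l *+ k).
Proof.
move=> al; elim: k => [|k IH]; first by rewrite expr0 mulr0n; exact: logder1.
by rewrite exprS mulrS; apply: logderM.
Qed.

Lemma logder_prod (I : eqType) (r : seq I) (f l : I -> fps A) :
  (forall i, i \in r -> logder (f i) (l i)) ->
  logder (\prod_(i <- r) f i) (\sum_(i <- r) l i).
Proof.
elim: r => [|i r IH] fl; first by rewrite !big_nil; exact: logder1.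
rewrite !big_cons; apply: logderM; first by apply: fl; rewrite mem_head.
by apply: IH => j jr; apply: fl; rewrite in_cons jr orbT.
Qed.

Lemma agree_theta n a b : agree n a b -> agree n (theta a) (theta b).
Proof. by move=> ab i le_in; rewrite /= ab. Qed.

Lemma prod_agree_low (f : nat -> fps A) m n :
  (forall d, (m <= d)%N -> agree m (f d.+1) 1) -> (m <= n)%N ->
  agree m (\prod_(1 <= d < n.+1) f d) (\prod_(1 <= d < m.+1) f d).
Proof.
move=> f1 le_mn; rewrite (big_cat_nat (n := m.+1)) //=.
rewrite -[X in agree _ _ X]mulr1; apply: agreeM => //.
apply: agree_prod1 => -[|d]; rewrite mem_index_iota // => /andP[md _]; exact: f1.
Qed.

Lemma geoX_agree1 x d n k : (n < d)%N -> agree n (geo x d ^+ k) 1.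
Proof. by move=> nd; rewrite -[X in agree _ _ X](expr1n _ k); apply: agreeX; apply: geo_agree1. Qed.

Lemma monoX_agree1 x d n k : (n < d)%N -> agree n ((1 - mono x d) ^+ k) 1.
Proof. by move=> nd; rewrite -[X in agree _ _ X](expr1n _ k); apply: agreeX; apply: mono_agree1. Qed.

Local Notation ones := (geo 1 1).

Lemma ones_mulE a n : (ones * a) n = \sum_(i < n.+1) a i.
Proof. by rewrite mulrC fpsME; apply: eq_bigr => i _; rewrite /= dvd1n expr1n mulr1. Qed.

Lemma onesX_coef r n : (ones ^+ r.+1) n = 'C(n + r, r)%:R.
Proof.
elim: r n => [|r IH] n; first by rewrite expr1 bin0 /= dvd1n expr1n.
rewrite exprS ones_mulE; under eq_bigr do rewrite IH.
rewrite -natr_sum; congr _%:R; elim: n => [|n IHn]; first by rewrite big_ord1 !binn.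
by rewrite big_ord_recr /= IHn [in RHS]addSn binS addSnnS.
Qed.

End FpsRing.
Notation ones A := (@geo A 1 1).

(** * Unique factorization *)

Section Factorization.
Variable F : finFieldType.
Implicit Types p f g : {poly F}.

Lemma monic_irred_monic p : monic_irred p -> p \is monic.
Proof. by case/andP. Qed.

Lemma monic_irredP p : monic_irred p -> irreducible_poly p.
Proof. by case/andP => _ /asboolP. Qed.

Lemma monic_irred_size p : monic_irred p -> (1 < size p)%N.
Proof. by move/monic_irredP => []. Qed.

Lemma monic_irred_pdeg_gt0 p : monic_irred p -> (0 < pdeg p)%N.
Proof. by rewrite /pdeg => /monic_irred_size; case: (size p) => [|[]]. Qed.

Lemma pdegM f g : f \is monic -> g \is monic -> pdeg (f * g) = (pdeg f + pdeg g)%N.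
Proof.
move=> mf mg; have g_neq0 := monic_neq0 mg.
have f_gt0 : (0 < size f)%N by rewrite size_poly_gt0 monic_neq0.
have g_gt0 : (0 < size g)%N by rewrite size_poly_gt0.
by rewrite /pdeg size_monicM //; lia.
Qed.

Lemma pdegX f e : f \is monic -> pdeg (f ^+ e) = (e * pdeg f)%N.
Proof.
move=> mf; elim: e => [|e IH]; first by rewrite expr0 /pdeg size_poly1.
by rewrite exprS pdegM ?monic_exp // IH mulSn.
Qed.

Lemma pdeg_prod (I : Type) (r : seq I) (G : I -> {poly F}) (e : I -> nat) :
  (forall i, G i \is monic) ->
  pdeg (\prod_(i <- r) G i ^+ e i) = (\sum_(i <- r) e i * pdeg (G i))%N.
Proof.
move=> mG; elim: r => [|i r IH]; first by rewrite !big_nil /pdeg size_poly1.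
by rewrite !big_cons pdegM ?pdegX ?monic_exp ?IH // monic_prod // => j _; rewrite monic_exp.
Qed.

Lemma size_pdeg f : f \is monic -> size f = (pdeg f).+1.
Proof. by move/monic_neq0; rewrite -size_poly_gt0 /pdeg => /prednK. Qed.

Lemma multiplicityE p g j : monic_irred p -> g != 0 -> ~~ (p %| g) ->
  multiplicity p (p ^+ j * g) = j.
Proof.
move=> ip g_neq0 ndv; have mp := monic_irred_monic ip.
have p_neq0 := monic_neq0 mp.
have dvE e : (p ^+ e %| p ^+ j * g) = (e <= j)%N.
  case: leqP => [le_ej|lt_je]; first by rewrite dvdp_mulr // dvdp_exp2l.
  apply/negP; rewrite -(subnKC (ltnW lt_je)) exprD dvdp_mul2l ?expf_neq0 //.
  move=> dv; case/negP: ndv; apply: dvdp_trans dv.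
  by rewrite -{1}(expr1 p) dvdp_exp2l // subn_gt0.
(* The maximum in [multiplicity] stops below the size of the polynomial, so [j] must lie in that
   range to be attained. *)
have sz : (j < size (p ^+ j * g)%R)%N.
  have := size_pdeg (monic_exp j mp); rewrite pdegX // => szX.
  rewrite size_mul ?expf_neq0 // szX; have := monic_irred_pdeg_gt0 ip.
  have : (0 < size g)%N by rewrite size_poly_gt0.
  move: (size g) (pdeg p) => a b; nia.
apply/eqP; rewrite /multiplicity eqn_leq; apply/andP; split.
  by apply/bigmax_leqP => e; rewrite dvE.
by apply: (leq_bigmax_cond (Ordinal sz)); rewrite dvE.
Qed.

Lemma monic_irred_dvd_eq p g : monic_irred p -> monic_irred g -> p %| g -> p = g.
Proof.
move=> ip ig dv; apply/eqP.
rewrite -eqp_monic ?monic_irred_monic //.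
have [_ irr] := monic_irredP ig; apply: irr => //.
by have := monic_irred_size ip; case: (size p) => [|[]].
Qed.

Lemma multiplicity_prod (I : finType) (P : I -> {poly F}) (v : I -> nat) i :
  (forall j, monic_irred (P j)) -> injective P ->
  multiplicity (P i) (\prod_j P j ^+ v j) = v i.
Proof.
move=> iP injP; rewrite (bigD1 i) //= multiplicityE //.
  rewrite monic_neq0 // monic_prod // => j _.
  by rewrite monic_exp ?monic_irred_monic.
have [Pi_gt1 irr] := monic_irredP (iP i).
apply/negP => dv; have : coprimep (P i) (\prod_(j | j != i) P j ^+ v j).
  elim/big_rec: _ => [|j x ji cx]; first exact: coprimep1.
  rewrite coprimepMr cx andbT coprimep_expr //.
  rewrite irreducible_poly_coprime; last exact: monic_irredP.
  by apply: contra ji => /(monic_irred_dvd_eq (iP i) (iP j))/injP ->.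
move/coprimepP => /(_ _ (dvdpp _) dv); rewrite -size_poly_eq1 => /eqP sz.
by rewrite sz in Pi_gt1.
Qed.

Definition irreds m : seq {poly F} :=
  [seq polyn x | x : {poly_m F} <- enum {: {poly_m F}} & monic_irred (polyn x)].

Lemma irreds_uniq m : uniq (irreds m).
Proof. by rewrite map_inj_uniq => [|x y /val_inj //]; apply/filter_uniq/enum_uniq. Qed.

Lemma mem_irreds m p : (p \in irreds m) = monic_irred p && (size p <= m)%N.
Proof.
apply/mapP/andP => [[x]|[ip szp]].
  by rewrite mem_filter => /andP [ip _] ->; split => //; apply: size_npoly.
by exists (NPoly szp) => //; rewrite mem_filter ip mem_enum.
Qed.

Lemma exists_irred_dvd f : f \is monic -> (1 < size f)%N ->
  exists2 p, monic_irred p & p %| f.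
Proof.
move=> mf; have [m] := ubnP (size f); elim: m f mf => // m IH f mf lt_fm sf.
have [irr|red] := pselect (irreducible_poly f).
  by exists f => //; rewrite /monic_irred mf; apply/asboolP.
have [g dvg /andP [sg ng]] : exists2 g, g %| f & (size g != 1%N) && ~~ (g %= f).
  apply: contrapT => nex; apply: red; split => // g sg dvg.
  by apply: contrapT => /negP ng; apply: nex; exists g; rewrite ?sg.
have f_neq0 := monic_neq0 mf.
have g_neq0 : g != 0 by apply: contraTneq dvg => ->; rewrite dvd0p.
have lcg : lead_coef g != 0 by rewrite lead_coef_eq0.
pose h := (lead_coef g)^-1 *: g.
have mh : h \is monic by rewrite monicE lead_coefZ mulVf.
have szh : size h = size g by rewrite size_scale ?invr_eq0.
have dvh : h %| f by rewrite dvdpZl ?invr_eq0.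
have szg : (size g < size f)%N.
  rewrite ltn_neqAle (dvdp_leq f_neq0 dvg) andbT.
  by apply: contra ng => /eqP e; rewrite -dvdp_size_eqp // e.
have [||p ip dvp] := IH h mh.
- by rewrite szh; apply: leq_trans szg _; rewrite -ltnS.
- by rewrite szh; move: sg g_neq0; rewrite -size_poly_gt0; case: (size g) => [|[]].
by exists p => //; apply: dvdp_trans dvh.
Qed.

Lemma factor_irreds m f : f \is monic -> (size f <= m)%N ->
  exists u : 'I_(size (irreds m)) -> nat,
    f = \prod_(i < size (irreds m)) (irreds m)`_i ^+ u i.
Proof.
have [s] := ubnP (size f); elim: s f => // s IH f lt_fs mf szf.
have [sz1|sf] := leqP (size f) 1.
  exists (fun=> 0%N); rewrite big1 => [|i _]; last exact: expr0.
  have f_neq0 := monic_neq0 mf.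
  have : size f == 1%N by rewrite eqn_leq sz1 size_poly_gt0.
  move=> /eqP sf1; have := size1_polyC (eq_leq sf1) => fE.
  by move: mf; rewrite fE monicE lead_coefC => /eqP ->.
have [p ip dvp] := exists_irred_dvd mf sf.
have mp := monic_irred_monic ip.
have [g fE] : exists g, f = p * g by exists (f %/ p); rewrite mulrC divpK.
have mg : g \is monic by rewrite -(monicMl _ mp) -fE.
have szE : size f = (pdeg p + pdeg g).+1 by rewrite size_pdeg // fE pdegM.
have szg : (size g < size f)%N.
  by rewrite szE (size_pdeg mg) ltnS; have := monic_irred_pdeg_gt0 ip; lia.
have [||u gE] := IH g _ mg.
- by apply: leq_trans szg _; rewrite -ltnS.
- by apply: leq_trans szf; apply: ltnW.
have pin : p \in irreds m.
  rewrite mem_irreds ip (leq_trans _ szf) // szE (size_pdeg mp); lia.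
have ltp : (index p (irreds m) < size (irreds m))%N by rewrite index_mem.
pose i0 := Ordinal ltp.
exists (fun i => (i == i0) + u i)%N.
under eq_bigr do rewrite exprD.
rewrite big_split /= -gE fE; congr (_ * _).
rewrite (bigD1 i0) //= eqxx expr1 big1 ?mulr1 ?nth_index //.
by move=> i /negbTE ->; rewrite expr0.
Qed.

Section Exponents.
Variable n : nat.
Let ps := irreds n.+1.
Let P (i : 'I_(size ps)) : {poly F} := ps`_i.
Let d i := pdeg (P i).
Let expo := {ffun 'I_(size ps) -> 'I_n.+1}.

Let P_irred i : monic_irred (P i).
Proof. by have := mem_nth 0 (ltn_ord i); rewrite mem_irreds => /andP[]. Qed.

Let P_inj : injective P.
Proof. by move=> i j /eqP; rewrite nth_uniq ?irreds_uniq // => /eqP/val_inj. Qed.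

Let P_monic i : P i \is monic. Proof. exact: monic_irred_monic. Qed.

(** Unique factorization as a bijection from exponent vectors of weight [n] to monic polynomials of
    degree [n]. Primes have positive degree, so exponents never exceed [n]; multiplicities give the
    inverse. *)
Let phi (v : expo) : {poly_n.+1 F} := npolyp n.+1 (\prod_i P i ^+ v i).

Let prod_monic (v : expo) : \prod_i P i ^+ v i \is monic.
Proof. by rewrite monic_prod // => i _; rewrite monic_exp. Qed.

Let phiE (v : expo) : (\sum_i v i * d i)%N = n -> phi v = \prod_i P i ^+ v i :> {poly F}.
Proof. by move=> vn; rewrite npolypK // size_pdeg // pdeg_prod // vn. Qed.

Let Omega_phi (v : expo) : (\sum_i v i * d i)%N = n ->
  Omega (phi v : {poly F}) = (\sum_i v i)%N.
Proof.
move=> vn; rewrite /Omega; set f := polyn (phi v).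
have fE : f = \prod_i P i ^+ v i := phiE vn.
have -> : size f = n.+1 by rewrite fE size_pdeg // pdeg_prod // vn.
transitivity (\sum_(p <- ps) multiplicity p f)%N.
  by rewrite /ps big_map big_filter big_enum_cond.
rewrite (big_nth 0) big_mkord; apply: eq_bigr => i _.
by rewrite fE (multiplicity_prod (fun i => v i) _ P_irred P_inj).
Qed.

Let V := [set v : expo | (\sum_i v i * d i)%N == n]%SET.

Let phi_inj : {in V &, injective phi}.
Proof.
move=> v w; rewrite !inE => /eqP vn /eqP wn /(congr1 (fun x => polyn x)).
rewrite !phiE // => e; apply/ffunP => i; apply/val_inj => /=.
rewrite -(multiplicity_prod (fun i => v i) i P_irred P_inj) e.
exact: (multiplicity_prod (fun i => w i) i P_irred P_inj).
Qed.

Let phi_onto (f : {poly_n.+1 F}) : polyn f \is monic -> pdeg (polyn f) = n ->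
  exists2 v, v \in V & f = phi v.
Proof.
move=> mf df.
have [u fE] := factor_irreds mf (size_npoly f).
have un : (\sum_i u i * d i)%N = n by rewrite -pdeg_prod // -fE.
have ule i : (u i < n.+1)%N.
  rewrite ltnS -[leqRHS]un (bigD1 i) //=.
  by have := monic_irred_pdeg_gt0 (P_irred i); rewrite -/(d i); nia.
pose v : expo := [ffun i => Ordinal (ule i)].
have vu i : v i = u i :> nat by rewrite ffunE.
have vn : (\sum_i v i * d i)%N = n by under eq_bigr do rewrite vu.
exists v; first by rewrite inE vn.
by apply/val_inj; rewrite /= phiE // [LHS]fE; apply: eq_bigr => i _; rewrite vu.
Qed.

Lemma N_exponents k : N F n k = #|[set v in V | (\sum_i v i)%N == k]%SET|.
Proof.
rewrite -(@card_in_imset _ _ phi) => [|v w]; last first.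
  by rewrite !inE => /andP[vV _] /andP[wV _]; apply: phi_inj; rewrite inE.
apply: eq_card => f; rewrite inE; apply/and3P/imsetP => [[mf /eqP df /eqP Of]|].
  have [v vV fE] := phi_onto mf df; exists v => //.
  have vn : (\sum_i v i * d i)%N = n by move: vV; rewrite inE => /eqP.
  by rewrite inE vV -Of fE Omega_phi ?eqxx.
case=> v; rewrite inE => /andP[]; rewrite inE => /eqP vn /eqP vk ->.
by rewrite phiE // prod_monic pdeg_prod // vn -phiE // Omega_phi // vk.
Qed.

(** The same monic polynomials are parametrized a second time as ['X^n + g] with [g] of size at most
    [n]. *)
Lemma card_exponents : #|V| = (#|F| ^ n)%N.
Proof.
rewrite -(card_in_imset phi_inj) -card_npoly.
pose psi (g : {poly_n F}) : {poly_n.+1 F} := npolyp n.+1 ('X^n + polyn g).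
have szg (g : {poly_n F}) : (size (polyn g) < size ('X^n : {poly F}))%N.
  by rewrite size_polyXn ltnS size_npoly.
have psiE (g : {poly_n F}) : psi g = 'X^n + polyn g :> {poly F}.
  by rewrite npolypK // size_polyDl // size_polyXn.
have psi_inj : injective psi.
  by move=> g h /(congr1 (fun x => polyn x)); rewrite !psiE => /addrI /val_inj.
rewrite -(card_imset _ psi_inj); apply: eq_card => f.
apply/imsetP/imsetP => [[v vV ->]|[g _ ->]].
  have vn : (\sum_i v i * d i)%N = n by move: vV; rewrite inE => /eqP.
  pose f0 := polyn (phi v); have f0E : f0 = \prod_i P i ^+ v i := phiE vn.
  have mf0 : f0 \is monic by rewrite f0E.
  have sf0 : size f0 = n.+1 by rewrite size_pdeg // f0E pdeg_prod // vn.
  have sz : (size (f0 - 'X^n)%R <= n)%N.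
    apply/leq_sizeP => j le_nj; rewrite coefB coefXn.
    case: eqP => [->|nj]; last by rewrite subr0 nth_default // sf0; lia.
    by move: mf0; rewrite monicE /lead_coef sf0 /= => /eqP ->; rewrite subrr.
  by exists (NPoly sz) => //; apply/val_inj; rewrite [RHS]psiE /= addrC subrK.
have mf : polyn (psi g) \is monic.
  by rewrite psiE monicE lead_coefDl ?szg ?lead_coefXn.
have [|v vV ->] := phi_onto mf; last by exists v.
by rewrite /pdeg psiE size_polyDl // size_polyXn.
Qed.

End Exponents.
End Factorization.

(** * Counting monic irreducible polynomials *)

Section Gauss.
Variable F : finFieldType.
Local Notation q := #|F|.

Definition nirred (d : nat) : nat := count (fun p : {poly F} => pdeg p == d) (irreds F d.+1).

Lemma card_field_gt1 : (1 < q)%N.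
Proof.
by apply/card_gt1P; exists (0 : F), (1 : F); split=> //; rewrite eq_sym oner_neq0.
Qed.

Lemma count_irreds m d : (d < m)%N ->
  count (fun p : {poly F} => pdeg p == d) (irreds F m) = nirred d.
Proof.
move=> lt_dm; rewrite /nirred -!size_filter; apply: perm_size.
apply: uniq_perm; rewrite ?filter_uniq ?irreds_uniq // => p.
rewrite !mem_filter !mem_irreds; case: eqP => //= pd.
case ip: (monic_irred p) => //=; rewrite (size_pdeg (monic_irred_monic ip)) pd.
by rewrite lt_dm leqnn.
Qed.

Lemma prod_irreds (A : comNzRingType) (f : nat -> A) m :
  \prod_(p <- irreds F m) f (pdeg p) = \prod_(1 <= d < m) f d ^+ nirred d.
Proof.
have gen (r : seq {poly F}) : (forall p, p \in r -> (1 <= pdeg p < m)%N) ->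
    \prod_(p <- r) f (pdeg p) = \prod_(1 <= d < m) f d ^+ count (fun p => pdeg p == d) r.
  elim: r => [|p r IH] hr; first by rewrite big_nil big1.
  rewrite big_cons IH => [|x xr]; last by apply: hr; rewrite in_cons xr orbT.
  under [RHS]eq_bigr do rewrite /= exprD.
  rewrite big_split /=; congr (_ * _).
  have /hr pm := mem_head p r.
  rewrite (bigD1_seq (pdeg p)) ?iota_uniq ?mem_index_iota //= eqxx expr1 big1 ?mulr1 //.
  by move=> d; rewrite eq_sym => /negbTE ->; rewrite expr0.
rewrite gen => [|p]; last first.
  rewrite mem_irreds => /andP[ip]; rewrite (size_pdeg (monic_irred_monic ip)) => ->.
  by rewrite monic_irred_pdeg_gt0.
by apply: eq_big_nat => d /andP[_ /count_irreds ->].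
Qed.

Section Zeta.
Variable R : numFieldType.
Local Notation rho := (q%:R^-1 : R).

Lemma cardR_neq0 : q%:R != 0 :> R.
Proof. by rewrite pnatr_eq0 -lt0n ltnW // card_field_gt1. Qed.

Lemma rhoVX n : rho ^+ n * q%:R ^+ n = 1.
Proof. by rewrite -exprMn mulVf ?expr1n // cardR_neq0. Qed.

(* The zeta function in the variable [q u], truncated to primes of degree at
   most [n]. *)
Definition zeta n : fps R := \prod_(1 <= d < n.+1) geo (rho ^+ d) d ^+ nirred d.

(** Every monic polynomial of degree [n] has weight [rho ^+ n], and there are [q ^ n] of them. *)
Lemma zeta_coef n : zeta n n = 1.
Proof.
rewrite /zeta -(prod_irreds (fun d => geo (rho ^+ d) d)) (big_nth 0) big_mkord.
rewrite (prod_geo_coef _ _ (leqnn n)) => [|i]; last first.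
  by have := mem_nth 0 (ltn_ord i); rewrite mem_irreds => /andP[/monic_irred_pdeg_gt0].
rewrite (eq_bigr (fun=> rho ^+ n)) => [|v /eqP vn]; last first.
  transitivity (rho ^+ (\sum_i v i * pdeg (irreds F n.+1)`_i)%N); last by congr (_ ^+ _).
  by rewrite -prodrXr; apply: eq_bigr => i _; rewrite -exprM mulnC.
rewrite sumr_const -[LHS]mulr_natr -[RHS](rhoVX n) -natrX -(card_exponents F n).
by congr (_ * _%:R); apply: eq_card => v; rewrite inE.
Qed.

Lemma zeta_agree n : agree n (zeta n) (ones R).
Proof.
move=> i le_in; rewrite (_ : zeta n i = zeta i i); last first.
  by apply: (prod_agree_low _ le_in (leqnn i)) => d id; apply: geoX_agree1.
by rewrite zeta_coef /= dvd1n expr1n.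
Qed.

(** Gauss's formula, by comparing two forms of the logarithmic derivative of zeta: a sum over
    degrees from the product, and [u / (1 - u)] from [1 / (1 - u)]. *)
Lemma sum_nirredR n : (0 < n)%N ->
  \sum_(1 <= d < n.+1 | (d %| n)%N) (d * nirred d)%:R = q%:R ^+ n :> R.
Proof.
move=> n_gt0.
pose L : fps R := \sum_(1 <= d < n.+1) ((geo (rho ^+ d) d - 1) *+ d) *+ nirred d.
have zL : logder (zeta n) L.
  apply: logder_prod => d; rewrite mem_index_iota => /andP[d_gt0 _].
  by apply: logderX; apply: theta_geo.
have Ln : L n = 1.
  have -> : L n = ((1 - mono 1 1) * theta (ones R)) n.
    rewrite -[L]mul1r -[X in X * L](geoK 1 (ltn0Sn 0)) -mulrA.
    apply: (agreeM _ _ (leqnn n)) => //.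
    move=> i le_in; rewrite -(agree_theta (@zeta_agree n) le_in) zL.
    by apply: (agreeM _ _ le_in) => // j le_jn; rewrite zeta_agree.
  rewrite mulrBl mul1r fpsDE fpsNE monoM_coef n_gt0 mul1r /= !dvd1n !expr1n.
  by rewrite -mulrnBr ?leq_subr // subKn.
rewrite -[RHS]mul1r -[X in _ = X * _]Ln /L fps_sumE big_distrl /= [LHS]big_mkcond /=.
apply: eq_big_nat => d /andP[d_gt0 _].
rewrite !fpsMnE fpsDE fpsNE fps1E gtn_eqF // oppr0 addr0 /=.
case: ifP => dn; last by rewrite !mul0rn mul0r.
rewrite -exprM muln_divA // mulKn //.
by rewrite -mulrnA mulrnAl rhoVX.
Qed.
End Zeta.

Lemma sum_nirred n : (0 < n)%N ->
  (\sum_(1 <= d < n.+1 | d %| n) d * nirred d)%N = (q ^ n)%N.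
Proof.
move=> n_gt0; apply/eqP; rewrite -(eqr_nat rat) natr_sum natrX.
exact/eqP/sum_nirredR.
Qed.
End Gauss.

(** Gauss's formula determines the counts recursively from the cardinality; this is why the constant
    depends only on [q]. *)
Lemma eq_nirred (F F' : finFieldType) d : #|F'| = #|F| -> nirred F' d = nirred F d.
Proof.
move=> FF'; have [m] := ubnP d; elim: m d => // m IH [|d] lt_dm.
  have nirred0 (K : finFieldType) : nirred K 0 = 0%N.
    apply/eqP; rewrite -leqn0 leqNgt -has_count; apply/hasPn => p.
    by rewrite mem_irreds => /andP[/monic_irred_pdeg_gt0]; case: (pdeg p).
  by rewrite !nirred0.
have := sum_nirred F (ltn0Sn d); rewrite -FF' -(sum_nirred F' (ltn0Sn d)).
rewrite big_mkcond big_nat_recr //= dvdnn.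
under eq_big_nat => e /andP[_ lt_ed] do rewrite -(IH e (leq_trans lt_ed _)) //.
by rewrite [RHS]big_mkcond big_nat_recr //= dvdnn => /addnI/eqP; rewrite eqn_pmul2l // => /eqP.
Qed.

(** * Absolute convergence of series *)

Section Norm.
Variable R : realType.
Implicit Types x y : fps R.

Definition psum x n := \sum_(i < n.+1) x i.

Lemma ones_psumE x n : (ones R * x) n = psum x n.
Proof. exact: ones_mulE. Qed.

Lemma psumS x n : psum x n.+1 = psum x n + x n.+1.
Proof. by rewrite /psum big_ord_recr. Qed.

Lemma psum_nd x : (forall i, 0 <= x i) -> {homo psum x : m n / (m <= n)%N >-> m <= n}.
Proof. by move=> x0; apply/nondecreasing_seqP => n; rewrite psumS lerDl. Qed.

Definition fabs x : fps R := Fps (fun n => `|x n|).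
Definition nrm n x := psum (fabs x) n.

Lemma nrm_ge0 n x : 0 <= nrm n x.
Proof. by apply: sumr_ge0 => i _; exact: normr_ge0. Qed.

Lemma nrm_nd x : {homo nrm^~ x : m n / (m <= n)%N >-> m <= n}.
Proof. by apply: psum_nd => i; exact: normr_ge0. Qed.

Lemma le_coef_nrm x n : `|x n| <= nrm n x.
Proof.
rewrite /nrm /psum big_ord_recr /= lerDr; apply: sumr_ge0 => i _; exact: normr_ge0.
Qed.

Lemma psum_le_nrm x n : `|psum x n| <= nrm n x.
Proof. exact: ler_norm_sum. Qed.

Lemma nrmD n x y : nrm n (x + y) <= nrm n x + nrm n y.
Proof. by rewrite /nrm /psum -big_split ler_sum // => i _; exact: ler_normD. Qed.

Lemma nrmN n x : nrm n (- x) = nrm n x.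
Proof. by apply: eq_bigr => i _; rewrite /= normrN. Qed.

Lemma nrm_agree n x y : agree n x y -> nrm n x = nrm n y.
Proof. by move=> xy; apply: eq_bigr => i _; rewrite /= xy // leq_ord. Qed.

(** Index pairs with sum at most [n] lie in a square. Partial summation is multiplication by [ones],
    and commutativity moves it onto the second factor. *)
Lemma nrmM n x y : nrm n (x * y) <= nrm n x * nrm n y.
Proof.
have -> : nrm n x * nrm n y = \sum_(j < n.+1) fabs x j * psum (fabs y) n.
  by rewrite -mulr_suml.
apply: (@le_trans _ _ (psum (fabs x * fabs y) n)).
  apply: ler_sum => i _; rewrite /= (le_trans (ler_norm_sum _ _ _)) //.
  by apply: ler_sum => j _; rewrite normrM.
rewrite -ones_psumE mulrCA fpsME; apply: ler_sum => j _.
rewrite ler_wpM2l ?normr_ge0 //.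
rewrite -[leLHS]/((ones R * fabs y) _) ones_psumE.
by apply: (nrm_nd y); apply: leq_subr.
Qed.

Lemma nrm1 n : nrm n 1 = 1.
Proof.
rewrite /nrm /psum big_ord_recl /= normr1 big1 ?addr0 // => i _.
exact: normr0.
Qed.

Lemma nrm_mono n a d : nrm n (mono a d) <= `|a|.
Proof.
rewrite /nrm /psum; case: (ltnP d n.+1) => [dn|nd].
  rewrite (bigD1 (Ordinal dn)) //= eqxx big1 ?addr0 // => i.
  by rewrite -val_eqE /= => /negbTE ->; rewrite normr0.
rewrite big1 // => i _; rewrite /= ifN ?normr0 //.
by have := ltn_ord i; lia.
Qed.

(** Measuring the distance to 1 makes bounds multiplicative, since [x * y - 1] expands in [x - 1]
    and [y - 1] with positive coefficients. It also controls tails of infinite products, which are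
    products close to 1. *)
Definition maj n x X := nrm n (x - 1) <= X - 1.

Lemma maj_nrm n x X : maj n x X -> nrm n x <= X.
Proof.
move=> xX; rewrite -(subrK 1 x) (le_trans (nrmD _ _ _)) // nrm1 -lerBrDr //.
Qed.

Lemma maj1 n : maj n 1 1.
Proof.
by rewrite /maj !subrr /nrm /psum big1 // => i _; rewrite /= normr0.
Qed.

Lemma majM n x y X Y : maj n x X -> maj n y Y -> maj n (x * y) (X * Y).
Proof.
rewrite /maj => xX yY.
have -> : x * y - 1 = (x - 1) * (y - 1) + (x - 1) + (y - 1) by ring.
have -> : X * Y - 1 = (X - 1) * (Y - 1) + (X - 1) + (Y - 1) by ring.
rewrite (le_trans (nrmD _ _ _)) // lerD // (le_trans (nrmD _ _ _)) // lerD //.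
by rewrite (le_trans (nrmM _ _ _)) // ler_pM ?nrm_ge0.
Qed.

Lemma majX n x X k : maj n x X -> maj n (x ^+ k) (X ^+ k).
Proof.
by move=> xX; elim: k => [|k IH]; [exact: maj1 | rewrite !exprS; apply: majM].
Qed.

Lemma maj_prod n (r : seq nat) (f : nat -> fps R) (X : nat -> R) :
  (forall i, i \in r -> maj n (f i) (X i)) ->
  maj n (\prod_(i <- r) f i) (\prod_(i <- r) X i).
Proof.
move=> fX; rewrite big_seq [X in maj _ _ X]big_seq.
by elim/big_rec2: _ => [|i x y ir xy]; [exact: maj1 | apply: majM => //; apply: fX].
Qed.

Section Factors.
Variables (a : R) (d : nat).
Hypotheses (a_ge0 : 0 <= a) (a_lt1 : a < 1) (d_gt0 : (0 < d)%N).

Lemma nrm_geo n : nrm n (geo a d) <= (1 - a)^-1.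
Proof.
have a1 : 0 < 1 - a by rewrite subr_gt0.
rewrite -[leRHS]mul1r ler_pdivlMr // mulrBr mulr1 lerBlDr {1}geoE //.
rewrite (le_trans (nrmD _ _ _)) // nrm1 lerD2l (le_trans (nrmM _ _ _)) // mulrC.
by rewrite ler_wpM2l ?nrm_ge0 // (le_trans (nrm_mono _ _ _)) // ger0_norm.
Qed.

Lemma maj_geo n : maj n (geo a d) (1 - a)^-1.
Proof.
have a1 : 0 < 1 - a by rewrite subr_gt0.
rewrite /maj geoE // addrAC subrr add0r (le_trans (nrmM _ _ _)) //.
have -> : (1 - a)^-1 - 1 = a * (1 - a)^-1 by field; rewrite gt_eqF.
rewrite ler_pM ?nrm_ge0 ?nrm_geo // (le_trans (nrm_mono _ _ _)) // ger0_norm //.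
Qed.

(** The sharper bound [1 + a] is given up so that [1 - a u^d] and its inverse share one majorant,
    whatever the sign of [q I_d - I_(d+1)]. *)
Lemma maj_mono n : maj n (1 - mono a d) (1 - a)^-1.
Proof.
have a1 : 0 < 1 - a by rewrite subr_gt0.
rewrite /maj addrAC subrr add0r nrmN (le_trans (nrm_mono _ _ _)) // ger0_norm //.
by rewrite lerBrDr -[leRHS]mul1r ler_pdivlMr //; nra.
Qed.

End Factors.

Definition abs_sum x (v : R) := (exists C, forall n, nrm n x <= C) /\ psum x n @[n --> \oo] --> v.

Lemma nrm_tail x m n : (m <= n)%N ->
  \sum_(j < n.+1 | (m < j)%N) `|x j| = nrm n x - nrm m x.
Proof.
move=> mn; rewrite /nrm /psum (big_ord_widen n.+1 (fun i => fabs x i) (mn : (m.+1 <= n.+1)%N)).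
rewrite [X in _ = X - _](bigID (fun j : 'I__ => (j < m.+1)%N)) /= addrAC subrr add0r.
by apply: eq_bigl => j; rewrite -leqNgt.
Qed.

Lemma conv_cvg0 x (e : R^nat) C : (forall n, nrm n x <= C) ->
  e n @[n --> \oo] --> (0 : R) ->
  \sum_(j < n.+1) `|x j| * `|e (n - j)%N| @[n --> \oo] --> (0 : R).
Proof.
move=> xC e0.
have C_ge0 : 0 <= C := le_trans (nrm_ge0 0 x) (xC 0%N).
have [M M_gt0 eM] : exists2 M, 0 < M & forall n, `|e n| <= M.
  have /cvg_seq_bounded [M [_ HM]] : cvgn e by apply/cvg_ex; exists 0.
  exists (`|M| + 1); first by rewrite ltr_wpDl.
  by move=> n; apply: HM => //; rewrite ltr_pwDr // ler_norm.
have Scvg : cvgn (nrm^~ x).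
  apply: nondecreasing_is_cvgn; first exact: nrm_nd.
  by exists C => _ [n _ <-]; exact: xC.
apply/cvgr0Pnorm_le => eps eps_gt0.
have C1 : 0 < C + 1 by rewrite ltr_wpDl.
have eps2 : 0 < eps / 2 / (C + 1) by rewrite !divr_gt0.
have eps3 : 0 < eps / 2 / M by rewrite !divr_gt0.
have /cvgr0Pnorm_le/(_ _ eps2) [N1 _ eN1] := e0.
have /cvgrPdist_le /(_ _ (divr_gt0 eps3 (@ltr0n R 2))) [N2 _ SN2] := Scvg.
near=> n.
have n_big : (N1 + N2 <= n)%N by near: n; exact: nbhs_infty_ge.
rewrite ger0_norm; last by apply: sumr_ge0 => j _; rewrite mulr_ge0.
(* Up to the cut [n - N1] the values [e (n - j)] are small and the [|x j|] have bounded sum; beyond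
   it [e] is merely bounded, but the tail of the [|x j|] is small. *)
pose m := (n - N1)%N.
have mN2 : (N2 <= m)%N by rewrite /m; lia.
have mn : (m <= n)%N by rewrite leq_subr.
have SS : nrm n x - nrm m x <= eps / 2 / M.
  have := SN2 _ mN2; have := SN2 n (leq_trans mN2 mn); rewrite !ler_distl.
  set l := lim _; set s := nrm n x; set t := nrm m x; set z := eps / 2 / M.
  move=> /andP[h1 h1'] /andP[h2 h2'].
  lra.
apply: (@le_trans _ _ (\sum_(j < n.+1) (`|x j| * (eps / 2 / (C + 1)) +
    (if (m < j)%N then `|x j| * M else 0)))).
  apply: ler_sum => j _; case: ifP => mj.
    by rewrite -[leLHS]add0r lerD // ?ler_wpM2l // mulr_ge0 // ltW.
  rewrite addr0 ler_wpM2l // eN1 //= leq_subRL; have := ltn_ord j.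
    by move: mj; rewrite /m; lia.
  by lia.
rewrite big_split /= -mulr_suml -big_mkcond /= -mulr_suml nrm_tail //.
rewrite [leRHS]splitr; apply: lerD; last by rewrite -ler_pdivlMr.
apply: (@le_trans _ _ (C * (eps / 2 / (C + 1)))).
  by rewrite ler_wpM2r ?(xC n) // ltW.
rewrite mulrCA; apply: ler_piMr; first by rewrite divr_ge0 ?ltW.
by rewrite ler_pdivrMr //; lra.
Unshelve. all: by end_near.
Qed.

Lemma psumM x y n : psum (x * y) n = \sum_(j < n.+1) x j * psum y (n - j)%N.
Proof.
rewrite -ones_psumE mulrCA fpsME.
by apply: eq_bigr => j _; rewrite -ones_psumE.
Qed.

(** Mertens' argument: [psum (x * y) n - psum x n * w] is the convolution of [x] with the null
    sequence [psum y - w]. *)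
Lemma abs_sumM x y v w : abs_sum x v -> abs_sum y w -> abs_sum (x * y) (v * w).
Proof.
move=> [[C xC] xv] [[D yD] yw]; split.
  exists (C * D) => n; rewrite (le_trans (nrmM _ _ _)) //.
  by rewrite ler_pM ?nrm_ge0.
have e0 : (fun n => psum y n - w) @ \oo --> (0 : R).
  by rewrite -(subrr w); apply: cvgB => //; apply: cvg_cst.
have diff0 : (fun n => psum (x * y) n - psum x n * w) @ \oo --> (0 : R).
  apply: norm_cvg0; apply: (squeeze_cvgr _ (cvg_cst 0) (conv_cvg0 xC e0)).
  near=> n; rewrite normr_ge0 /= psumM /psum mulr_suml -sumrB.
  rewrite (le_trans (ler_norm_sum _ _ _)) // ler_sum // => j _.
  by rewrite -mulrBr normrM.
rewrite -[v * w]add0r.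
have -> : (fun n => psum (x * y) n) =
    (fun n => (psum (x * y) n - psum x n * w) + psum x n * w).
  by apply/funext => n; rewrite subrK.
by apply: cvgD => //; apply: cvgMl.
Unshelve. all: by end_near.
Qed.

Lemma abs_sum1 : abs_sum 1 1.
Proof.
split; first by exists 1 => n; rewrite nrm1.
rewrite (_ : (fun n => _) = fun=> 1); first exact: cvg_cst.
apply/funext => n; rewrite /psum big_ord_recl /= big1 ?addr0 // => i _.
Qed.

Lemma abs_sumX x v k : abs_sum x v -> abs_sum (x ^+ k) (v ^+ k).
Proof.
by move=> xv; elim: k => [|k IH]; [exact: abs_sum1 | rewrite !exprS; apply: abs_sumM].
Qed.

Lemma abs_sum_prod (r : seq nat) (f : nat -> fps R) (X : nat -> R) :
  (forall i, i \in r -> abs_sum (f i) (X i)) ->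
  abs_sum (\prod_(i <- r) f i) (\prod_(i <- r) X i).
Proof.
move=> fX; rewrite big_seq [X in abs_sum _ X]big_seq.
by elim/big_rec2: _ => [|i x y ir xy]; [exact: abs_sum1 | apply: abs_sumM => //; apply: fX].
Qed.

Lemma psum_mono a d n : (d <= n)%N -> psum (mono a d) n = a.
Proof.
move=> dn; have dn1 : (d < n.+1)%N by [].
rewrite /psum (bigD1 (Ordinal dn1)) //= eqxx big1 ?addr0 // => i.
by rewrite -val_eqE /= => /negbTE ->.
Qed.

Lemma psumB x y n : psum (x - y) n = psum x n - psum y n.
Proof. by rewrite /psum -sumrB. Qed.

Lemma psum1 n : psum 1 n = 1.
Proof. by rewrite -mono10 psum_mono. Qed.

Lemma abs_sum_mono a d : abs_sum (1 - mono a d) (1 - a).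
Proof.
split.
  exists (1 + `|a|) => n; rewrite (le_trans (nrmD _ _ _)) // nrm1 nrmN lerD2l.
  exact: nrm_mono.
apply: cvg_near_cst; near=> n; rewrite psumB psum1 psum_mono //.
near: n; exact: nbhs_infty_ge.
Unshelve. all: by end_near.
Qed.

Lemma abs_sum_geo a d : 0 <= a -> a < 1 -> (0 < d)%N -> abs_sum (geo a d) (1 - a)^-1.
Proof.
move=> a_ge0 a_lt1 d_gt0.
have a1 : 1 - a != 0 by rewrite subr_eq0 gt_eqF.
have geo_ge0 i : 0 <= geo a d i by rewrite /=; case: ifP => // _; rewrite exprn_ge0.
have bnd n : nrm n (geo a d) <= (1 - a)^-1 by exact: nrm_geo.
have cv : cvgn (psum (geo a d)).
  apply: nondecreasing_is_cvgn; first exact: psum_nd.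
  exists (1 - a)^-1 => _ [n _ <-]; apply: le_trans (bnd n).
  by rewrite (le_trans _ (psum_le_nrm _ _)) // ler_norm.
set l := lim (psum (geo a d) @ \oo) in cv *.
have gl : abs_sum (geo a d) l by split; [exists (1 - a)^-1 | exact: cv].
(* Monotonicity only provides some limit [l]; its value follows by summing
   [(1 - a u^d) * geo a d = 1]. *)
have := abs_sumM (abs_sum_mono a d) gl; rewrite geoK // => -[_ c1].
have l1 : (1 - a) * l = 1.
  apply: (cvg_unique (@norm_hausdorff _ _) c1).
  rewrite (_ : (fun n => _) = fun=> 1); first exact: cvg_cst.
  by apply/funext => n; rewrite psum1.
by have -> : (1 - a)^-1 = l by apply: (mulfI a1); rewrite mulfV.
Qed.

(** Weights at least 1 have divergent total, which washes out the finitely many early terms. *)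
Lemma weighted_cesaro (w y : R^nat) (l : R) : (forall n, 1 <= w n) ->
  y n @[n --> \oo] --> l ->
  (\sum_(i < n.+1) w i * y i) / (\sum_(i < n.+1) w i) @[n --> \oo] --> l.
Proof.
move=> w1 yl.
have w0 n : 0 <= w n by rewrite (le_trans ler01).
have Wn n : n.+1%:R <= \sum_(i < n.+1) w i.
  rewrite -[X in X%:R <= _]card_ord -sumr_const; exact: ler_sum.
have W_gt0 n : 0 < \sum_(i < n.+1) w i by rewrite (lt_le_trans _ (Wn n)).
apply/cvgrPdist_le => eps eps_gt0.
have eps2 : 0 < eps / 2 by rewrite divr_gt0.
have /cvgrPdist_le /(_ _ eps2) [N _ yN] := yl.
pose C := \sum_(i < N) w i * `|l - y i|.
have C_ge0 : 0 <= C by apply: sumr_ge0 => i _; rewrite mulr_ge0.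
near=> n.
have nN : (N <= n.+1)%N by rewrite leqW //; near: n; exact: nbhs_infty_ge.
have nC : C / (eps / 2) <= n.+1%:R.
  rewrite (@le_trans _ _ n%:R) // ?ler_nat //; near: n; exact: nbhs_infty_ger.
have W_neq0 : \sum_(i < n.+1) w i != 0 by rewrite gt_eqF.
rewrite -[X in X - _](mulfK W_neq0) -mulrBl normrM.
rewrite normfV (ger0_norm (ltW (W_gt0 n))) ler_pdivrMr //.
rewrite mulr_sumr -sumrB (le_trans (ler_norm_sum _ _ _)) //.
apply: (@le_trans _ _ (\sum_(i < n.+1) ((if (i < N)%N then w i * `|l - y i| else 0) +
   w i * (eps / 2)))).
  apply: ler_sum => i _; rewrite mulrC -mulrBr normrM (ger0_norm (w0 i)).
  case: ltnP => iN; first by rewrite lerDl mulr_ge0 // ltW.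
  by rewrite add0r ler_wpM2l // yN.
rewrite big_split /= -big_mkcond /= -(big_ord_widen _ (fun i => w i * `|l - y i|) nN).
rewrite -mulr_suml -/C [eps in leRHS]splitr mulrDl lerD //; last by rewrite mulrC.
rewrite mulrC -ler_pdivrMr // (le_trans nC) //.
Unshelve. all: by end_near.
Qed.

(** One more factor [ones] averages the previous quotient with weights ['C(i + r, r)], whose total
    is the next binomial coefficient. *)
Lemma iterated_sum_asymptotics x (l : R) r : psum x n @[n --> \oo] --> l ->
  (ones R ^+ r.+1 * x) n / 'C(n + r, r)%:R @[n --> \oo] --> l.
Proof.
move=> xl; elim: r => [|r IH].
  rewrite (_ : (fun n => _) = psum x) //; apply/funext => n.
  by rewrite expr1 ones_psumE bin0 divr1.
rewrite (_ : (fun n => _) = fun n => (\sum_(i < n.+1) 'C(i + r, r)%:R *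
    ((ones R ^+ r.+1 * x) i / 'C(i + r, r)%:R)) / \sum_(i < n.+1) 'C(i + r, r)%:R).
  apply: (@weighted_cesaro (fun i => 'C(i + r, r)%:R)
    (fun i => (ones R ^+ r.+1 * x) i / 'C(i + r, r)%:R) l) => // n.
  by rewrite ler1n bin_gt0 leq_addl.
apply/funext => n; rewrite exprS -mulrA ones_psumE -onesX_coef exprS ones_psumE /psum.
congr (_ / _); last by apply: eq_bigr => i _; rewrite onesX_coef.
apply: eq_bigr => i _; rewrite mulrCA divff ?mulr1 // pnatr_eq0 -lt0n bin_gt0.
exact: leq_addl.
Qed.

End Norm.

(** * Prime counts and the product H *)

Section Bounds.
Variable F : finFieldType.
Local Notation q := #|F|.

Lemma nirred_le d : (0 < d)%N -> (d * nirred F d <= q ^ d)%N.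
Proof.
by move=> d_gt0; rewrite -(sum_nirred F d_gt0) big_mkcond big_nat_recr //= dvdnn leq_addl.
Qed.

Lemma sum_expn_le m : (\sum_(1 <= e < m.+1) q ^ e <= 2 * q ^ m)%N.
Proof.
have q_gt1 := card_field_gt1 F.
elim: m => [|m IH]; first by rewrite big_geq.
rewrite big_nat_recr //= expnS; move: IH; set S := (\sum_(_ <= _ < _) _)%N.
have : (0 < q ^ m)%N by rewrite expn_gt0 ltnW.
move: (q ^ m)%N => t; move: q_gt1; move: q => Q; nia.
Qed.

(** Proper divisors are at most [d./2] and together cost at most [2 * q ^ d./2]; then
    [d * q ^ d./2 <= 2 * q ^ d] yields the 4. After division by [d ^ 2 * q ^ d] the error is
    summable. *)
Lemma nirred_ge d : (0 < d)%N -> (d * q ^ d <= d * (d * nirred F d) + 4 * q ^ d)%N.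
Proof.
move=> d_gt0; have q_gt1 := card_field_gt1 F.
have half_le : (q ^ d <= d * nirred F d + 2 * q ^ d./2)%N.
  rewrite -[leqLHS](sum_nirred F d_gt0) big_mkcond big_nat_recr //= dvdnn addnC leq_add2l.
  apply: leq_trans (sum_expn_le _).
  have d2 : (d./2.+1 <= d)%N by lia.
  rewrite (big_cat_nat _ d2) //= [X in (_ + X)%N]big1_seq ?addn0.
    rewrite big_nat_cond [leqRHS]big_nat_cond.
    apply: leq_sum => e; rewrite andbT => /andP[e_gt0 _].
    by case: ifP => // _; exact: nirred_le.
  move=> e /=; rewrite mem_index_iota => /andP[de ed]; case: ifP => // /dvdnP[k dk].
  have : (k = 0 \/ k = 1 \/ 2 <= k)%N by lia.
  by case=> [|[|]]; nia.
have up : (d * q ^ d./2 <= 2 * q ^ d)%N.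
  have d2 : (d./2 <= d)%N by lia.
  rewrite -[in leqRHS](subnKC d2) expnD.
  rewrite [leqLHS]mulnC [leqRHS]mulnCA leq_pmul2l ?expn_gt0 ?(ltnW q_gt1) //.
  apply: (@leq_trans (2 * (d - d./2))%N); first by lia.
  by rewrite leq_pmul2l // (leq_trans (ltnW (ltn_expl _ q_gt1))).
apply: leq_trans (leq_mul (leqnn d) half_le) _.
by rewrite mulnDr leq_add2l mulnCA (leq_trans (leq_mul (leqnn 2) up)) // mulnA.
Qed.

Variable R : realType.
Local Notation rho := (q%:R^-1 : R).

Lemma q_ge2 : (2 : R) <= q%:R.
Proof. by rewrite ler_nat card_field_gt1. Qed.

Lemma rho_gt0 : 0 < rho.
Proof. by rewrite invr_gt0 (lt_le_trans _ q_ge2). Qed.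

Lemma rho_le : rho <= 2^-1.
Proof. by rewrite lef_pV2 ?posrE ?q_ge2 // (lt_le_trans _ q_ge2). Qed.

Lemma rhoX_gt0 d : 0 < rho ^+ d.
Proof. by rewrite exprn_gt0 ?rho_gt0. Qed.

Lemma rhoX_le d : (0 < d)%N -> rho ^+ d <= rho.
Proof.
move=> d_gt0; rewrite -[leRHS]expr1 ler_wiXn2l // ?ltW ?rho_gt0 //.
by have := rho_le; lra.
Qed.

Definition dens d : R := (nirred F d)%:R * rho ^+ d.

Lemma dens_le d : (0 < d)%N -> dens d <= d%:R^-1.
Proof.
move=> d_gt0; have d0 : 0 < d%:R :> R by rewrite ltr0n.
rewrite -[leRHS]mul1r ler_pdivlMr // /dens mulrAC -natrM mulnC -[leRHS](rhoVX F R d) mulrC.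
by rewrite ler_pM2l ?rhoX_gt0 // -natrX ler_nat nirred_le.
Qed.

Lemma dens_ge d : (0 < d)%N -> d%:R^-1 - 4 * d%:R^-1 ^+ 2 <= dens d.
Proof.
move=> d_gt0; have d0 : 0 < d%:R :> R by rewrite ltr0n.
have := nirred_ge d_gt0; rewrite -(ler_nat R) natrD !natrM natrX => h.
have := ler_wpM2r (ltW (rhoX_gt0 d)) h.
rewrite mulrDl -!mulrA [q%:R ^+ d * _]mulrC rhoVX !mulr1 -/(dens d).
set y := dens d; move=> {}h.
have -> : d%:R^-1 - 4 * d%:R^-1 ^+ 2 = (d%:R - 4) / d%:R ^+ 2 :> R.
  by field; rewrite gt_eqF.
by rewrite ler_pdivrMr ?exprn_gt0 //; move: h; lra.
Qed.

(** This is [|q I_d - I_(d+1)|], as one of the two truncated differences is zero. *)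
Definition cdist d := ((q * nirred F d - nirred F d.+1) + (nirred F d.+1 - q * nirred F d))%N.

(* Both [q I_d] and [I_(d+1)] have size [q^(d+1) / d]; only their difference is
   small enough for the sum over [d] to converge. *)
Lemma cdist_le d : (0 < d)%N ->
  (cdist d)%:R * rho ^+ d <= 8 * q%:R * (d%:R^-1 - d.+1%:R^-1).
Proof.
move=> d_gt0; have d1 : (1 : R) <= d%:R by rewrite ler1n.
have q0 := cardR_neq0 F R; have q2 := q_ge2.
have E0 : (q * nirred F d)%:R * rho ^+ d = q%:R * dens d by rewrite natrM -mulrA.
have E1 : (nirred F d.+1)%:R * rho ^+ d = q%:R * dens d.+1.
  by rewrite /dens exprS [RHS]mulrCA (mulrA q%:R) divff // mul1r.
have a1 := dens_le d_gt0; have a2 := dens_ge d_gt0.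
have b1 := dens_le (ltn0Sn d); have b2 := dens_ge (ltn0Sn d).
have key1 : dens d - dens d.+1 <= 8 * (d%:R^-1 - d.+1%:R^-1).
  apply: (@le_trans _ _ (d%:R^-1 - d.+1%:R^-1 + 4 * d.+1%:R^-1 ^+ 2)).
    by move: (dens d) (dens d.+1) (d%:R^-1) (d.+1%:R^-1) a1 b2 => x y z t; lra.
  rewrite -natr1; set t := d%:R in d1 *.
  have -> : 8 * (t^-1 - (t + 1)^-1) = (8 * (t + 1)) / (t * (t + 1) ^+ 2).
    by field; lra.
  have -> : t^-1 - (t + 1)^-1 + 4 * (t + 1)^-1 ^+ 2 = (t + 1 + 4 * t) / (t * (t + 1) ^+ 2).
    by field; lra.
  by rewrite ler_pM2r ?invr_gt0; nra.
have key2 : dens d.+1 - dens d <= 8 * (d%:R^-1 - d.+1%:R^-1).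
  apply: (@le_trans _ _ (d.+1%:R^-1 - d%:R^-1 + 4 * d%:R^-1 ^+ 2)).
    by move: (dens d) (dens d.+1) (d%:R^-1) (d.+1%:R^-1) a2 b1 => x y z t; lra.
  rewrite -natr1; set t := d%:R in d1 *.
  have -> : 8 * (t^-1 - (t + 1)^-1) = (8 * t) / (t ^+ 2 * (t + 1)).
    by field; lra.
  have -> : (t + 1)^-1 - t^-1 + 4 * t^-1 ^+ 2 = (4 * (t + 1) - t) / (t ^+ 2 * (t + 1)).
    by field; lra.
  by rewrite ler_pM2r ?invr_gt0; nra.
have [le|/ltnW le] := leqP (nirred F d.+1) (q * nirred F d).
  rewrite /cdist (eqP le) addn0 natrB // mulrBl E0 E1 -mulrBr -mulrA mulrCA.
  by rewrite ler_wpM2l // (le_trans _ q2).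
rewrite /cdist (eqP le) add0n natrB // mulrBl E0 E1 -mulrBr -mulrA mulrCA.
by rewrite ler_wpM2l // (le_trans _ q2).
Qed.

(** For [y >= 0], [(1 - y) * (1 + 3 * y) >= 1] holds exactly up to [2 / 3], which is the value of
    [2 / q] at [q = 3]. *)
Lemma inv1B_le (y : R) : 0 <= y -> y <= 2 / 3 -> (1 - y)^-1 <= expR (3 * y).
Proof.
move=> y0 y1; apply: le_trans (expR_ge1Dx _).
by rewrite -[leLHS]mul1r ler_pdivrMr; nra.
Qed.

Definition Kprod D : R := \prod_(1 <= d < D.+1) (1 - rho ^+ d)^-1 ^+ cdist d.

Lemma rhoX_lt1 d : (0 < d)%N -> rho ^+ d < 1.
Proof. by move=> /rhoX_le; have := rho_le; lra. Qed.

Lemma Kfactor_ge1 d : (0 < d)%N -> 1 <= (1 - rho ^+ d)^-1 ^+ cdist d.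
Proof.
move=> d_gt0; rewrite exprn_ege1 // invf_ge1 ?subr_gt0 ?rhoX_lt1 // gerBl ltW ?rhoX_gt0 //.
Qed.

Lemma Kprod_bound D : Kprod D <= expR (24 * q%:R).
Proof.
(* The induction needs a telescoping bound; 24 is the 3 of [inv1B_le] times the 8 of [cdist_le]. *)
apply: (@le_trans _ _ (expR (24 * q%:R * (1 - D.+1%:R^-1)))); last first.
  rewrite ler_expR ler_piMr ?mulr_ge0 // gerBl invr_ge0.
rewrite /Kprod; elim: D => [|D IH]; first by rewrite big_geq // invr1 subrr mulr0 expR0.
rewrite big_nat_recr //=.
have -> : 24 * q%:R * (1 - D.+2%:R^-1) = 24 * q%:R * (1 - D.+1%:R^-1) +
   3 * (8 * q%:R * (D.+1%:R^-1 - D.+2%:R^-1)) :> R by ring.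
rewrite expRD; apply: ler_pM => //.
- rewrite big_nat_cond; apply: prodr_ge0 => d; rewrite andbT => /andP[d_gt0 _].
  by rewrite (le_trans ler01) ?Kfactor_ge1.
- by rewrite (le_trans ler01) ?Kfactor_ge1.
have y0 := ltW (rhoX_gt0 D.+1).
have y1 : rho ^+ D.+1 <= 2 / 3 by have := rhoX_le (ltn0Sn D); have := rho_le; lra.
apply: (@le_trans _ _ (expR (3 * rho ^+ D.+1) ^+ cdist D.+1)).
  by rewrite lerXn2r ?nnegrE ?expR_ge0 ?inv1B_le // invr_ge0 subr_ge0 (ltW (rhoX_lt1 (ltn0Sn D))).
by rewrite -expRM_natl ler_expR mulrCA ler_wpM2l ?cdist_le.
Qed.

Lemma Kprod_ge1 D : 1 <= Kprod D.
Proof.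
rewrite /Kprod; elim: D => [|D IH]; first by rewrite big_geq.
by rewrite big_nat_recr //= mulr_ege1 ?Kfactor_ge1.
Qed.

Lemma Kprod_gt0 D : 0 < Kprod D.
Proof. exact: lt_le_trans (Kprod_ge1 D). Qed.

Lemma Kprod_cat m n : (m <= n)%N ->
  Kprod n = Kprod m * \prod_(m.+1 <= d < n.+1) (1 - rho ^+ d)^-1 ^+ cdist d.
Proof. by move=> mn; rewrite /Kprod (big_cat_nat (n := m.+1)). Qed.

Lemma Kprod_nd : {homo Kprod : m n / (m <= n)%N >-> m <= n}.
Proof.
apply/nondecreasing_seqP => n; rewrite /Kprod [leRHS]big_nat_recr //=.
by rewrite ler_peMr ?Kfactor_ge1 // ltW ?Kprod_gt0.
Qed.

Lemma Kprod_cvg : cvgn Kprod.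
Proof.
apply: nondecreasing_is_cvgn; first exact: Kprod_nd.
by exists (expR (24 * q%:R)) => _ [n _ <-]; exact: Kprod_bound.
Qed.

(* [Efac d] has the exponent [q I_d - I_(d+1)], written without cancellation. *)
Definition Efac d : fps R :=
  (1 - mono (rho ^+ d) d) ^+ (q * nirred F d) * geo (rho ^+ d) d ^+ nirred F d.+1.

Definition Hprod D := \prod_(1 <= d < D.+1) Efac d.

Definition vfac d : R := (1 - rho ^+ d) ^+ (q * nirred F d) * (1 - rho ^+ d)^-1 ^+ nirred F d.+1.

Definition Vprod D := \prod_(1 <= d < D.+1) vfac d.

(** Cancelling before estimating leaves the exponent [cdist]; majorants of the two powers taken
    separately would diverge. *)
Lemma exp_cancel (A : comNzRingType) (x y : A) m k : x * y = 1 ->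
  x ^+ m * y ^+ k = x ^+ (m - k) * y ^+ (k - m).
Proof.
move=> xy; have cancel a b : x ^+ (a + b) * y ^+ a = x ^+ b.
  by rewrite exprD mulrAC -exprMn xy expr1n mul1r.
have [le|/ltnW le] := leqP k m; rewrite (eqP le) expr0.
  by rewrite mulr1 -{1}(subnKC le) cancel.
by rewrite mul1r -{1}(subnKC le) mulrC exprD mulrAC -exprMn mulrC [y * x]mulrC xy expr1n mulr1.
Qed.

Lemma maj_Efac n d : (0 < d)%N -> maj n (Efac d) ((1 - rho ^+ d)^-1 ^+ cdist d).
Proof.
move=> d_gt0; rewrite /Efac exp_cancel ?geoK // /cdist exprD.
have y0 := ltW (rhoX_gt0 d); have y1 := rhoX_lt1 d_gt0.
by apply: majM; apply: majX; [exact: maj_mono | exact: maj_geo].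
Qed.

Lemma abs_sum_Hprod D : abs_sum (Hprod D) (Vprod D).
Proof.
apply: abs_sum_prod => d; rewrite mem_index_iota => /andP[d_gt0 _].
have y0 := ltW (rhoX_gt0 d); have y1 := rhoX_lt1 d_gt0.
by apply: abs_sumM; apply: abs_sumX; [exact: abs_sum_mono | exact: abs_sum_geo].
Qed.

(** Together with [Kprod_bound] this keeps the limit of [Vprod] away from 0, so that one may divide
    by it. *)
Lemma Vprod_ge D : (Kprod D)^-1 <= Vprod D.
Proof.
rewrite /Kprod /Vprod -prodfV; rewrite big_nat_cond [leRHS]big_nat_cond.
apply: ler_prod => d; rewrite andbT => /andP[d_gt0 _].
have y0 := rhoX_gt0 d; have y1 := rhoX_lt1 d_gt0.
have u0 : 0 < 1 - rho ^+ d by rewrite subr_gt0.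
rewrite invr_ge0 exprn_ge0 ?invr_ge0 ?(ltW u0) //=.
rewrite /vfac exp_cancel ?divff ?gt_eqF // exprVn invrK /cdist exprD.
rewrite ler_pM ?exprn_ge0 ?(ltW u0) //.
apply: (@le_trans _ _ 1); first by rewrite exprn_ile1 ?(ltW u0) // gerBl ltW.
by rewrite exprn_ege1 // invf_ge1 // gerBl ltW.
Qed.

Lemma Hprod_agree m n : (m <= n)%N -> agree m (Hprod n) (Hprod m).
Proof.
move=> mn; apply: prod_agree_low => // d md; rewrite -[1]mulr1.
by apply: agreeM; [apply: monoX_agree1 | apply: geoX_agree1].
Qed.

(** [Hprod D] factors out of the difference, and what remains is a product minus 1, as controlled by
    [maj]. *)
Lemma nrm_HprodB D n : (D <= n)%N -> nrm n (Hprod n - Hprod D) <= Kprod n - Kprod D.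
Proof.
move=> Dn.
have -> : Hprod n = Hprod D * \prod_(D.+1 <= d < n.+1) Efac d.
  by rewrite /Hprod (big_cat_nat (n := D.+1)).
rewrite (Kprod_cat Dn) -{2}[Hprod D]mulr1 -{2}[Kprod D]mulr1 -!mulrBr.
have mE a b : (0 < a)%N -> maj n (\prod_(a <= d < b) Efac d)
    (\prod_(a <= d < b) (1 - rho ^+ d)^-1 ^+ cdist d).
  move=> a_gt0; apply: maj_prod => d; rewrite mem_index_iota => /andP[ad _].
  by apply: maj_Efac; apply: leq_trans ad.
rewrite (le_trans (nrmM _ _ _)) // ler_pM ?nrm_ge0 //; last exact: mE.
by apply: maj_nrm; apply: mE.
Qed.

(** The infinite product, read diagonally: factors of index above [n] are 1 modulo [u^(n+1)]. *)
Definition hser : fps R := Fps (fun n => Hprod n n).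

Lemma hser_agree n : agree n (Hprod n) hser.
Proof. by move=> i le_in; rewrite (Hprod_agree le_in). Qed.

(** Interchanges the limit of products with summation. [D] is fixed first; the tail estimate then
    holds for all [n >= D], and [n] grows only for the single series [Hprod D]. *)
Lemma psum_hser (L : R) : Vprod D @[D --> \oo] --> L -> psum hser n @[n --> \oo] --> L.
Proof.
move=> VL; apply/cvgrPdist_le => eps eps_gt0.
have e3 : 0 < eps / 3 by rewrite divr_gt0.
have /cvgrPdist_le /(_ _ e3) [N1 _ VN] := VL.
have /cvgrPdist_le /(_ _ (divr_gt0 e3 (@ltr0n R 2))) [N2 _ KN] := Kprod_cvg.
pose D := maxn N1 N2.
have [_ /cvgrPdist_le /(_ _ e3) HD] := abs_sum_Hprod D.
near=> n.
have Dn : (D <= n)%N by near: n; exact: nbhs_infty_ge.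
have h1 : `|L - Vprod D| <= eps / 3 by apply: VN; rewrite /= leq_maxl.
have h2 : `|Vprod D - psum (Hprod D) n| <= eps / 3 by near: n.
have h3 : `|psum hser n - psum (Hprod D) n| <= eps / 3.
  rewrite -psumB (le_trans (psum_le_nrm _ _)) //.
  have -> : nrm n (hser - Hprod D) = nrm n (Hprod n - Hprod D).
    by apply: nrm_agree => i le_in; rewrite !fpsDE hser_agree.
  rewrite (le_trans (nrm_HprodB Dn)) //.
  have := KN n (leq_trans (leq_maxr _ _) Dn); have := KN D (leq_maxr _ _).
  rewrite !ler_distl; move: (Kprod n) (Kprod D) (lim _) (eps / 3) => a b c e.
  move=> /andP[h4 h5] /andP[h6 h7]; lra.
move: h1 h2 h3; rewrite !ler_distl; move: (psum (Hprod D) n) => a.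
move=> /andP[h4 h5] /andP[h6 h7] /andP[h8 h9]; apply/andP; lra.
Unshelve. all: by end_near.
Qed.

(* Up to index [s], the coefficients at [i] sum [z ^ Omega g / q ^ i] over the
   products [g] of nonlinear primes with [pdeg g - Omega g = i]. *)
Definition wser (z : R) s : fps R := \prod_(1 <= d < s.+1) geo (z * rho ^+ d) d ^+ nirred F d.+1.

(** Multiplying and dividing each factor by the power [q * I_d] of the same geometric series
    extracts [q] copies of zeta and leaves [Efac]. *)
Lemma wser1_agree s : agree s (wser 1 s) (ones R ^+ q * hser).
Proof.
have -> : wser 1 s = zeta F R s ^+ q * Hprod s.
  rewrite /wser /zeta /Hprod -prodrXl -big_split /=; apply: eq_big_nat => d /andP[d_gt0 _].
  rewrite mul1r /Efac mulrA -exprM [(q * _)%N]mulnC -exprMn.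
  by rewrite [geo _ _ * (1 - _)]mulrC geoK // expr1n mul1r.
apply: agreeM; last exact: hser_agree.
by apply: agreeX; apply: zeta_agree.
Qed.

Theorem wser1_asymptotics (L : R) : Vprod D @[D --> \oo] --> L ->
  wser 1 s s / 'C(s + q.-1, q.-1)%:R @[s --> \oo] --> L.
Proof.
move=> VL; rewrite (_ : (fun s => _) =
    fun s => (ones R ^+ q.-1.+1 * hser) s / 'C(s + q.-1, q.-1)%:R).
  by apply: iterated_sum_asymptotics; apply: psum_hser.
apply/funext => s; rewrite prednK; last exact: ltnW (card_field_gt1 F).
by rewrite (wser1_agree (leqnn s)).
Qed.

(** By [inv1B_le] at [2 * rho ^+ d] and the bound on [I_(d+1)], factor [d] is at most
    [exp (6 q / (d + 1))], hence at most [((d + 1) / d) ^ (6 q)], and the product telescopes. *)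
Lemma wser2_le s : (2 < q)%N -> wser 2 s s <= s.+1%:R ^+ (6 * q).
Proof.
move=> q_gt2; have q3 : (3 : R) <= q%:R by rewrite ler_nat.
have rho3 : rho <= 3^-1 by rewrite lef_pV2 ?posrE // (lt_le_trans _ q3).
have small d : (0 < d)%N -> 2 * rho ^+ d <= 2 / 3.
  by move=> /rhoX_le h; rewrite ler_wpM2l // (le_trans h).
have small0 d : 0 <= 2 * rho ^+ d by rewrite mulr_ge0 // ltW ?rhoX_gt0.
have lt1 d : (0 < d)%N -> 2 * rho ^+ d < 1 by move=> /small; lra.
apply: le_trans (ler_norm _) _; apply: le_trans (le_coef_nrm _ _) _.
have /maj_nrm : maj s (wser 2 s)
    (\prod_(1 <= d < s.+1) (1 - 2 * rho ^+ d)^-1 ^+ nirred F d.+1).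
  apply: maj_prod => d; rewrite mem_index_iota => /andP[d_gt0 _].
  by apply: majX; apply: maj_geo => //; apply: lt1.
move/le_trans; apply.
apply: (@le_trans _ _ (\prod_(1 <= d < s.+1) (d.+1%:R / d%:R) ^+ (6 * q))); last first.
  rewrite prodrXl; apply: lerXn2r; rewrite ?nnegrE //.
    by apply: prodr_ge0 => d _; rewrite divr_ge0.
  elim: s => [|s IH]; first by rewrite big_geq.
  by rewrite big_nat_recr //= -ler_pdivlMr ?divr_gt0 // invf_div mulrCA divff ?mulr1.
rewrite big_nat_cond [leRHS]big_nat_cond; apply: ler_prod => d.
rewrite andbT => /andP[d_gt0 _].
have d0 : 0 < d%:R :> R by rewrite ltr0n.
rewrite exprn_ge0 ?invr_ge0 ?subr_ge0 ?(ltW (lt1 _ d_gt0)) //=.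
apply: (@le_trans _ _ (expR (3 * (2 * rho ^+ d)) ^+ nirred F d.+1)).
  by rewrite lerXn2r ?nnegrE ?expR_ge0 ?inv1B_le ?small // invr_ge0 subr_ge0 (ltW (lt1 _ d_gt0)).
apply: (@le_trans _ _ (expR d.+1%:R^-1 ^+ (6 * q))).
  rewrite -!expRM_natl ler_expR natrM.
  have -> : (nirred F d.+1)%:R * (3 * (2 * rho ^+ d)) = 6 * q%:R * dens d.+1.
    rewrite /dens exprS; set r := rho ^+ d; set I := (_%:R : R).
    by field; rewrite gt_eqF // (lt_le_trans _ q3).
  by rewrite ler_wpM2l ?mulr_ge0 // dens_le.
rewrite lerXn2r ?nnegrE ?expR_ge0 ?divr_ge0 //.
rewrite -[leLHS]invrK -expRN -[leRHS]invrK lef_pV2 ?posrE ?expR_gt0 ?invr_gt0 ?divr_gt0 //.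
apply: le_trans (expR_ge1Dx _); rewrite invf_div -natr1.
rewrite le_eqVlt; apply/orP; left; apply/eqP; field.
by rewrite gt_eqF // ltr_wpDl // ltW.
Qed.
End Bounds.

(** * The Euler product *)

Section Euler.
Variable R : realType.

Lemma bernoulli_ineq (x : R) k : 0 <= x <= 1 -> 1 - k%:R * x <= (1 - x) ^+ k.
Proof.
move=> /andP[x0 x1]; elim: k => [|k IH]; first by rewrite mul0r subr0 expr0.
rewrite exprS; apply: (@le_trans _ _ ((1 - x) * (1 - k%:R * x))); last first.
  by rewrite ler_wpM2l // subr_ge0.
have : 0 <= k%:R * x * x by rewrite !mulr_ge0.
by rewrite -natr1; lra.
Qed.

Lemma prod_ge1_subset (T : eqType) (s t : seq T) (P : pred T) (f : T -> R) :
  uniq s -> uniq t -> {subset s <= t} -> (forall x, P x -> 1 <= f x) ->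
  \prod_(x <- s | P x) f x <= \prod_(x <- t | P x) f x.
Proof.
move=> us ut st f1.
have ge1 r : 1 <= \prod_(x <- r | P x) f x.
  by elim/big_rec: _ => // x y Px y1; rewrite mulr_ege1 ?f1.
have pt : perm_eq t (s ++ [seq x <- t | x \notin s]).
  apply: uniq_perm => // [|x].
    rewrite cat_uniq us filter_uniq // andbT; apply/hasPn => x.
    by rewrite mem_filter => /andP[].
  rewrite mem_cat mem_filter; have := st x.
  by case: (x \in s) => //= ->.
rewrite (perm_big _ pt) big_cat /= ler_peMr //.
by rewrite (le_trans ler01).
Qed.

Section Field.
Variable F : finFieldType.
Local Notation q := #|F|.
Local Notation rho := (q%:R^-1 : R).

Definition efac d : R := (1 - rho ^+ d.-1)^-1 * (1 - rho ^+ d) ^+ q.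
Definition Eprod D : R := \prod_(2 <= d < D.+1) efac d ^+ nirred F d.

Lemma euler_factorE (p : {poly F}) : euler_factor R p = efac (pdeg p).
Proof. by rewrite /euler_factor /efac !exprVn. Qed.

(** Bernoulli bounds the numerator below by [1 - q * rho ^+ d], which is the denominator. Factors at
    least 1 make the Euler product monotone, hence independent of order. *)
Lemma efac_ge1 d : (2 <= d)%N -> 1 <= efac d.
Proof.
case: d => // d; rewrite ltnS => d_gt0.
have y1 := rhoX_lt1 F R d_gt0.
rewrite /efac mulrC ler_pdivlMr ?subr_gt0 // mul1r.
apply: le_trans (bernoulli_ineq q _); last first.
  by rewrite (ltW (rhoX_gt0 F R d.+1)) (ltW (rhoX_lt1 F R (ltn0Sn d))).
by rewrite /= [rho ^+ d.+1]exprS mulVKf ?cardR_neq0.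
Qed.

Lemma nirred1 : nirred F 1 = q.
Proof. by have := sum_nirred F (ltn0Sn 0); rewrite big_mkcond big_nat1 dvd1n mul1n expn1. Qed.

(** Regrouping pairs the exponent [I_(d+1)] at [d] with [q * I_(d+1)] at [d + 1]. [I_1 = q] supplies
    the power [q ^ 2], and one boundary factor stays unpaired. *)
Lemma Vprod_Eprod D :
  Vprod F R D * (1 - rho ^+ D.+1) ^+ (q * nirred F D.+1) =
  (1 - rho) ^+ (q ^ 2) * Eprod D.+1.
Proof.
elim: D => [|D IH].
  by rewrite /Vprod /Eprod !big_geq // mul1r mulr1 expr1 nirred1 mulnn.
have -> : Vprod F R D.+1 = Vprod F R D * vfac F R D.+1 by rewrite /Vprod big_nat_recr.
have -> : Eprod D.+2 = Eprod D.+1 * efac D.+2 ^+ nirred F D.+2.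
  by rewrite /Eprod big_nat_recr.
rewrite [RHS]mulrA -IH.
by rewrite /vfac /efac exprMn -exprM !mulrA.
Qed.

Lemma Vprod_le D : Vprod F R D <= Kprod F R D.
Proof.
rewrite /Vprod /Kprod big_nat_cond [leRHS]big_nat_cond.
apply: ler_prod => d; rewrite andbT => /andP[d_gt0 _].
have y0 := rhoX_gt0 F R d; have y1 := rhoX_lt1 F R d_gt0.
have u0 : 0 < 1 - rho ^+ d by rewrite subr_gt0.
have u1 : 1 - rho ^+ d <= 1 by rewrite gerBl ltW.
rewrite /vfac mulr_ge0 ?exprn_ge0 ?invr_ge0 ?(ltW u0) //=.
rewrite exp_cancel ?divff ?gt_eqF // /cdist exprD ler_pM ?exprn_ge0 ?invr_ge0 ?(ltW u0) //.
apply: (@le_trans _ _ 1); first by rewrite exprn_ile1 ?(ltW u0).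
by rewrite exprn_ege1 // invf_ge1.
Qed.

Lemma Eprod_nd : {homo Eprod : m n / (m <= n)%N >-> m <= n}.
Proof.
apply/nondecreasing_seqP => -[|n]; first by rewrite /Eprod !big_geq.
have E0 : 0 <= Eprod n.+1.
  rewrite /Eprod big_nat_cond; apply: prodr_ge0 => d; rewrite andbT => /andP[d2 _].
  by rewrite exprn_ge0 // (le_trans ler01) ?efac_ge1.
rewrite [leRHS]/Eprod big_nat_recr //= ler_peMr //.
by rewrite exprn_ege1 // efac_ge1.
Qed.

Lemma Eprod_cvg : cvgn Eprod.
Proof.
apply: nondecreasing_is_cvgn; first exact: Eprod_nd.
have rho1 : 0 < 1 - rho by have := rho_le F R; lra.
exists (expR (24 * q%:R) / (1 - rho) ^+ (q ^ 2)) => _ [n _ <-].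
apply: (le_trans (Eprod_nd (leqnSn n))).
rewrite ler_pdivlMr ?exprn_gt0 // mulrC -Vprod_Eprod.
apply: le_trans (Kprod_bound F R n); apply: le_trans (Vprod_le n).
have V0 : 0 <= Vprod F R n.
  by apply: le_trans (Vprod_ge F R n); rewrite invr_ge0 ltW ?Kprod_gt0.
rewrite ler_piMr // exprn_ile1 ?subr_ge0 ?(ltW (rhoX_lt1 F R (ltn0Sn n))) // gerBl (ltW (rhoX_gt0 F R n.+1)) //.
Qed.

Definition Elim : R := lim (Eprod n @[n --> \oo]).

Lemma Vprod_cvg : Vprod F R D @[D --> \oo] --> (1 - rho) ^+ (q ^ 2) * Elim.
Proof.
(* The boundary factor tends to 1: by Bernoulli and [dens_le] it is at least [1 - q / (D + 1)]. *)
pose g D : R := (1 - rho ^+ D.+1) ^+ (q * nirred F D.+1).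
have g1 : g D @[D --> \oo] --> (1 : R).
  apply: (@squeeze_cvgr _ _ _ _ (fun D => 1 - q%:R * D.+1%:R^-1) (fun=> 1)); last 2 first.
  - rewrite -[X in _ --> X](subr0 1) -(mulr0 q%:R); apply: cvgB; first exact: cvg_cst.
    by apply: cvgMr; exact: cvg_harmonic.
  - exact: cvg_cst.
  near=> D.
  have y0 := ltW (rhoX_gt0 F R D.+1); have y1 := ltW (rhoX_lt1 F R (ltn0Sn D)).
  apply/andP; split; last by rewrite exprn_ile1 ?subr_ge0 // gerBl.
  apply: le_trans (bernoulli_ineq _ _); last by rewrite y0.
  rewrite lerD2l lerN2 natrM -mulrA ler_wpM2l //.
  exact: (dens_le F R (ltn0Sn D)).
have g0 D : g D != 0.
  by rewrite expf_neq0 // subr_eq0 eq_sym lt_eqF // rhoX_lt1.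
rewrite (_ : Vprod F R = fun D => (1 - rho) ^+ (q ^ 2) * Eprod D.+1 / g D); last first.
  by apply/funext => D; rewrite -Vprod_Eprod mulfK ?g0.
rewrite -[X in _ --> X]divr1; apply: cvgM.
  apply: cvgMr; rewrite (cvg_shiftS Eprod); exact: Eprod_cvg.
by apply: cvgV => //; exact: oner_neq0.
Unshelve. all: by end_near.
Qed.

Lemma lim_Vprod_gt0 : 0 < (1 - rho) ^+ (q ^ 2) * Elim.
Proof.
apply: (@lt_le_trans _ _ (expR (24 * q%:R))^-1); first by rewrite invr_gt0 expR_gt0.
rewrite -(cvg_lim (@Rhausdorff R) Vprod_cvg); apply: limr_ge; first exact: cvgP Vprod_cvg.
near=> D; apply: le_trans (Vprod_ge F R D).
by rewrite lef_pV2 ?posrE ?expR_gt0 ?Kprod_gt0 // Kprod_bound.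
Unshelve. all: by end_near.
Qed.

Lemma Eprod_irreds D :
  \prod_(p <- irreds F D.+1 | in_P_ge2 p) euler_factor R p = Eprod D.
Proof.
under eq_bigr do rewrite euler_factorE.
rewrite big_seq_cond (eq_bigl (fun p => (p \in irreds F D.+1) && (2 <= pdeg p)%N)); last first.
  move=> p; case pin: (p \in _) => //=.
  by move: pin; rewrite mem_irreds /in_P_ge2 => /andP[-> _].
rewrite -big_seq_cond big_mkcond (prod_irreds F (fun d => if (2 <= d)%N then efac d else 1)).
rewrite /Eprod; case: D => [|D]; first by rewrite !big_geq.
rewrite big_ltn //= expr1n mul1r; apply: eq_big_nat => d /andP[-> _] //.
Qed.

(** By monotonicity, a finite set containing all primes of degree up to [N0] has its product between
    [Eprod N0] and [Elim]. *)
Lemma partial_euler_product_cvg : partial_euler_product R (F := F) @ totally --> Elim.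
Proof.
have ef1 (p : {poly F}) : in_P_ge2 p -> 1 <= euler_factor R p.
  by move=> /andP[_ p2]; rewrite euler_factorE efac_ge1.
have ? : ProperFilter (@totally {poly F}) := totally_filter.
apply/cvgrPdist_le => eps eps_gt0.
have /cvgrPdist_le /(_ _ eps_gt0) [N0 _ EN] := Eprod_cvg.
exists [fset p in irreds F N0.+1]%fset => // A /= NA.
have le1 : Eprod N0 <= partial_euler_product R A.
  rewrite -Eprod_irreds; apply: prod_ge1_subset; rewrite ?irreds_uniq ?fset_uniq //.
  by move=> p pin; apply: (fsubsetP NA); rewrite inE.
have le2 : partial_euler_product R A <= Elim.
  pose m := (\max_(p <- enum_fset A) size p)%N.
  apply: (@le_trans _ _ (Eprod m)); last exact: (nondecreasing_cvgn_le Eprod_nd Eprod_cvg).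
  rewrite -Eprod_irreds /partial_euler_product.
  (* [A] may contain other polynomials; they are filtered out to obtain an inclusion into
     [irreds]. *)
  rewrite (_ : \prod_(p <- A | in_P_ge2 p) euler_factor R p =
    \prod_(p <- [seq p <- enum_fset A | in_P_ge2 p] | in_P_ge2 p) euler_factor R p); last first.
    by rewrite big_filter_cond; apply: eq_bigl => p; rewrite andbb.
  apply: prod_ge1_subset; rewrite ?irreds_uniq ?filter_uniq ?fset_uniq //.
  move=> p; rewrite mem_filter mem_irreds => /andP[/andP[-> _] pA] /=.
  by rewrite leqW // /m (big_rem p) //= leq_maxl.
have := EN N0 (leqnn N0); rewrite !ler_distl -/Elim => /andP[h1 h2].
by apply/andP; split; lra.
Qed.

Lemma CqE : Cq R F = (((q.-1)`!)%:R ^+ 2)^-1 * ((1 - rho) ^+ (q ^ 2) * Elim).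
Proof.
have ? : ProperFilter (@totally {poly F}) := totally_filter.
by rewrite /Cq /euler_product (cvg_lim (@Rhausdorff R) partial_euler_product_cvg) mulrA.
Qed.

End Field.

Lemma eq_Elim (F F' : finFieldType) : #|F'| = #|F| -> Elim F' = Elim F.
Proof.
move=> FF'; rewrite /Elim; have -> // : Eprod F' = Eprod F; apply/funext => D.
by apply: eq_big_nat => d _; rewrite /efac FF' (eq_nirred d FF').
Qed.

Lemma eq_Cq (F F' : finFieldType) : #|F'| = #|F| -> Cq R F' = Cq R F.
Proof. by move=> FF'; rewrite !CqE (eq_Elim FF') FF'. Qed.

End Euler.

(** * Separating the linear factors *)

Section Decomposition.
Variables (R : realType) (F : finFieldType).
Local Notation q := #|F|.
Local Notation rho := (q%:R^-1 : R).

Lemma prodXr_coef (I : finType) (v e : I -> nat) s :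
  (\prod_i ('X^(e i) : {poly R}) ^+ v i)`_s = ((\sum_i v i * e i)%N == s)%:R.
Proof.
rewrite (eq_bigr (fun i => 'X^(v i * e i) : {poly R})) => [|i _].
  by rewrite prodrXr coefXn eq_sym.
by rewrite -exprM mulnC.
Qed.

(* The series variable marks [Omega] and the polynomial variable marks
   [pdeg - Omega], so that a linear prime contributes [ones]. *)
Lemma N_coef n k : (k <= n)%N ->
  (N F n k)%:R =
  ((\prod_(p <- irreds F n.+1) geo ('X^((pdeg p).-1) : {poly R}) 1) k)`_(n - k).
Proof.
move=> kn; rewrite (big_nth 0) big_mkord (prod_geo_coef _ _ kn) // coef_sum N_exponents.
under eq_bigr do rewrite prodXr_coef.
rewrite -natr_sum -big_mkcondr /= sum1_card; congr _%:R; apply: eq_card => v.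
rewrite !inE unfold_in /= andbC.
have -> : (\sum_i v i * 1 = \sum_i v i)%N by apply: eq_bigr => i _; rewrite muln1.
case: eqP => //= vk.
have -> : (\sum_i v i * pdeg (irreds F n.+1)`_i =
    \sum_i v i * (pdeg (irreds F n.+1)`_i).-1 + k)%N.
  rewrite -vk -big_split /=; apply: eq_bigr => i _.
  have := mem_nth 0 (ltn_ord i); rewrite mem_irreds => /andP[/monic_irred_pdeg_gt0].
  by move: (pdeg _) => [|d] //= _ _; rewrite mulnS addnC.
by rewrite -(eqn_add2r k (\sum_i _)%N) subnK.
Qed.

(** Substitutes a number for the marker of [Omega]: the weight [z ^+ m * rho ^+ s] splits into
    powers of the [z * rho ^+ d i]. As [d i >= 1], no [m] above [s] occurs. *)
Lemma mark_sum (I : finType) (d : I -> nat) s M (z : R) :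
  (forall i, 0 < d i)%N -> (s <= M)%N ->
  (\sum_(m < M.+1) ((\prod_i geo ('X^(d i) : {poly R}) 1) m)`_s * z ^+ m) * rho ^+ s =
  (\prod_i geo (z * rho ^+ d i) (d i)) s.
Proof.
move=> d_gt0 sM; rewrite (prod_geo_coef _ d_gt0 sM).
transitivity ((\sum_(m < M.+1) \sum_(v : {ffun I -> 'I_M.+1})
   (if (\sum_i v i * d i == s)%N && (\sum_i v i == m)%N then z ^+ m else 0)) * rho ^+ s).
  congr (_ * _); apply: eq_bigr => m _.
  rewrite (prod_geo_coef _ _ (leq_ord m)) // coef_sum mulr_suml big_mkcond /=.
  apply: eq_bigr => v _; rewrite prodXr_coef.
  have -> : (\sum_i v i * 1 = \sum_i v i)%N by apply: eq_bigr => i _; rewrite muln1.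
  by case: (_ == s) => /=; case: (_ == _); rewrite ?mul1r ?mul0r.
rewrite exchange_big /= mulr_suml [RHS]big_mkcond /=; apply: eq_bigr => v _.
case: eqP => [vs|_]; last by rewrite big1 ?mul0r.
have vM : (\sum_i v i < M.+1)%N.
  rewrite ltnS (leq_trans _ sM) // -vs leq_sum // => i _.
  by rewrite leq_pmulr.
rewrite -big_mkcond (big_pred1 (Ordinal vM)) => [|m]; last by rewrite /= eq_sym.
rewrite -vs -!prodrXr -big_split /=; apply: eq_bigr => i _.
by rewrite mulnC exprM -exprMn.
Qed.

Definition nonlinear n : seq {poly F} := [seq p <- irreds F n.+1 | (1 < pdeg p)%N].

Lemma prod_nonlinear (A : comNzRingType) (f : nat -> A) n : (0 < n)%N ->
  \prod_(p <- nonlinear n) f (pdeg p).-1 = \prod_(1 <= d < n) f d ^+ nirred F d.+1.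
Proof.
move=> n_gt0; rewrite big_filter big_mkcond /=.
rewrite (prod_irreds F (fun d => if (1 < d)%N then f d.-1 else 1)).
rewrite big_ltn //= expr1n mul1r big_add1 /=.
by apply: eq_big_nat => d /andP[d_gt0 _]; rewrite ltnS d_gt0.
Qed.

Lemma prod_irreds_split (f : nat -> fps {poly R}) n : (0 < n)%N ->
  \prod_(p <- irreds F n.+1) f (pdeg p).-1 = f 0 ^+ q * \prod_(p <- nonlinear n) f (pdeg p).-1.
Proof.
move=> n_gt0; rewrite prod_nonlinear // (prod_irreds F (fun d => f d.-1)).
by rewrite big_ltn //= nirred1 big_add1.
Qed.

(** [e m] counts products of [m] nonlinear primes with excess [n - k]. The last property is used at
    [z = 1] for the total and at [z = 2] for the mean of [m]. *)
Lemma N_decomposition n k : (0 < k)%N -> (k <= n)%N ->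
  exists e : nat -> R, [/\ forall m, 0 <= e m,
    (N F n k)%:R = \sum_(m < k.+1) 'C(k - m + q.-1, q.-1)%:R * e m &
    forall z M, (n - k <= M)%N ->
      \sum_(m < M.+1) e m * z ^+ m = q%:R ^+ (n - k) * wser F z (n - k)%N (n - k)%N].
Proof.
move=> k_gt0 kn; have n_gt0 : (0 < n)%N by apply: leq_trans kn.
have q_gt0 : (0 < q)%N by apply: ltnW (card_field_gt1 F).
set s := (n - k)%N.
pose Q : fps {poly R} := \prod_(p <- nonlinear n) geo ('X^((pdeg p).-1) : {poly R}) 1.
have QE : Q = \prod_(i < size (nonlinear n)) geo ('X^((pdeg (nonlinear n)`_i).-1) : {poly R}) 1.
  by rewrite /Q (big_nth 0) big_mkord.
have d_gt0 (i : 'I_(size (nonlinear n))) : (0 < (pdeg (nonlinear n)`_i).-1)%N.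
  have := mem_nth 0 (ltn_ord i); rewrite mem_filter => /andP[+ _].
  by case: (pdeg _) => [|[]].
exists (fun m => (Q m)`_s); split.
- move=> m; rewrite QE (prod_geo_coef _ _ (leqnn m)) // coef_sum; apply: sumr_ge0 => v _.
  by rewrite prodXr_coef.
- rewrite (N_coef kn) (prod_irreds_split (fun d => geo ('X^d : {poly R}) 1)) // -/Q -/s.
  rewrite expr0 mulrC fpsME coef_sum; apply: eq_bigr => m _.
  by rewrite -{1}(prednK q_gt0) onesX_coef mulr_natr coefMn mulr_natl.
- move=> z M sM; have := mark_sum z d_gt0 sM; rewrite -QE.
  rewrite -(big_mkord xpredT (fun i => geo (z * rho ^+ (pdeg (nonlinear n)`_i).-1) (pdeg (nonlinear n)`_i).-1)).
  rewrite -(big_nth 0 xpredT (fun p => geo (z * rho ^+ (pdeg p).-1) (pdeg p).-1)).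
  rewrite (prod_nonlinear (fun d => geo (z * rho ^+ d) d)) //.
  (* Since [k > 0], the primes of degree up to [n] include those of degree up to [s + 1]; higher
     ones do not reach coefficient [s]. *)
  have sn : (s.+1 <= n)%N by rewrite /s; lia.
  rewrite -(prednK n_gt0) => h.
  have -> : wser F z s s = (\prod_(1 <= d < n.-1.+1) geo (z * rho ^+ d) d ^+ nirred F d.+1) s.
    symmetry; apply: (prod_agree_low _ _ (leqnn s)); last by lia.
    by move=> d sd; apply: geoX_agree1.
  by rewrite -h mulrC -mulrA rhoVX mulr1.
Qed.
End Decomposition.

(** * The asymptotic formula *)

Section Binomial.
Variable R : realType.
Implicit Types k r : nat.

Lemma bin_lower k r : (k ^ r <= 'C(k + r, r) * r`!)%N.
Proof.
rewrite bin_ffact; elim: r => [|r IH]; first by rewrite ffactn0.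
by rewrite addnS ffactSS expnS leq_mul // leqW // leq_addr.
Qed.

Lemma ffact_le_exp n r : (n ^_ r <= n ^ r)%N.
Proof.
elim: r n => [|r IH] n; first by rewrite ffactn0.
rewrite ffactnS expnS leq_mul // (leq_trans (IH _)) //.
by case: r {IH} => // r; rewrite leq_exp2r // leq_pred.
Qed.

Lemma bin_asymptotics r :
  'C(k + r, r)%:R * r`!%:R / k%:R ^+ r @[k --> \oo] --> (1 : R).
Proof.
apply: (@squeeze_cvgr _ _ _ _ (fun=> 1) (fun k => (1 + r%:R * k%:R^-1) ^+ r)).
- near=> k; have k_gt0 : (0 < k)%N by near: k; exact: nbhs_infty_gt.
  have k0 : 0 < k%:R :> R by rewrite ltr0n.
  apply/andP; split.
    by rewrite ler_pdivlMr ?exprn_gt0 // mul1r -natrX -natrM ler_nat bin_lower.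
  rewrite ler_pdivrMr ?exprn_gt0 // -exprMn mulrDl mul1r mulfVK ?gt_eqF //.
  by rewrite -natrD -natrX -natrM ler_nat bin_ffact ffact_le_exp.
- exact: cvg_cst.
- have inv0 : k%:R^-1 @[k --> \oo] --> (0 : R).
    apply/gtr0_cvgV0; last exact: cvgr_idn.
    by near=> k; rewrite ltr0n; near: k; exact: nbhs_infty_gt.
  have lin1 : 1 + r%:R * k%:R^-1 @[k --> \oo] --> (1 : R).
    rewrite -[X in _ --> X]addr0 -(mulr0 r%:R).
    by apply: cvgD; [exact: cvg_cst | exact: cvgMr].
  rewrite -[X in _ --> X](expr1n R r).
  exact: (@continuous_cvg _ R R \oo _ _ (fun x : R => x ^+ r) _ (@exprn_continuous R r 1) lin1).
Unshelve. all: by end_near.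
Qed.

End Binomial.

Section Final.
Variables (R : realType) (F : finFieldType).
Local Notation q := #|F|.
Local Notation r := (q.-1).
Local Notation rho := (q%:R^-1 : R).
Hypothesis q_gt2 : (2 < q)%N.

Definition acoef s : R := wser F 1 s s.
Definition Lcst : R := (1 - rho) ^+ (q ^ 2) * Elim R F.

Lemma le_tilt m T : m%:R <= T%:R + 2 ^+ m / 2 ^+ T :> R.
Proof.
have [mT|Tm] := leqP m T.
  by rewrite ler_wpDr ?ler_nat // divr_ge0 // exprn_ge0.
rewrite -(subnKC (ltnW Tm)) exprD mulrAC divff ?expf_neq0 // mul1r natrD lerD2l.
by rewrite -natrX ler_nat ltnW // ltn_expl.
Qed.

(** Above, each binomial coefficient is at most the one at [m = 0]. Below,
    [(1 - m / k) ^ r >= 1 - r * m / k] reduces the loss to the mean of [m]; the size of [T] bounds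
    the exponential moment, whence the [+ 1]. *)
Lemma N_bounds n k T : (0 < k)%N -> (k <= n)%N -> (n.+1 ^ (6 * q) <= 2 ^ T)%N ->
  (N F n k)%:R <= 'C(k + r, r)%:R * (q%:R ^+ (n - k) * acoef (n - k)) /\
  k%:R ^+ r * q%:R ^+ (n - k) *
    (acoef (n - k) - r%:R / k%:R * (T%:R * acoef (n - k) + 1)) <= (N F n k)%:R * r`!%:R.
Proof.
move=> k_gt0 kn nT; have [e [e_ge0 NE eE]] := N_decomposition R F k_gt0 kn.
set s := (n - k)%N in eE *; set a := acoef s.
have sn : (s <= n)%N by rewrite leq_subr.
have k0 : 0 < k%:R :> R by rewrite ltr0n.
have q0 : 0 < q%:R :> R by rewrite ltr0n ltnW // ltnW.
have E1 : \sum_(m < n.+1) e m = q%:R ^+ s * a.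
  by rewrite -(eE 1 n sn); apply: eq_bigr => m _; rewrite expr1n mulr1.
have widen (f : nat -> R) : \sum_(m < k.+1) f m = \sum_(m < n.+1 | (m < k.+1)%N) f m.
  exact: big_ord_widen.
split.
  rewrite NE -E1 mulr_sumr.
  rewrite (widen (fun m => 'C(k - m + r, r)%:R * e m)) big_mkcond.
  apply: ler_sum => m _; case: ifP => _; last by rewrite mulr_ge0.
  by rewrite ler_wpM2r // ler_nat leq_bin2l // leq_add2r leq_subr.
have E2 : \sum_(m < n.+1) m%:R * e m <= q%:R ^+ s * (T%:R * a + 1).
  apply: (@le_trans _ _ (\sum_(m < n.+1) (T%:R * e m + (2 ^+ T)^-1 * (e m * 2 ^+ m)))).
    apply: ler_sum => m _.
    have -> : T%:R * e m + (2 ^+ T)^-1 * (e m * 2 ^+ m) =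
        (T%:R + 2 ^+ m / 2 ^+ T) * e m :> R by ring.
    by rewrite ler_wpM2r // le_tilt.
  rewrite big_split /= -!mulr_sumr E1 eE //.
  rewrite mulrDr mulr1 [X in X + _]mulrCA lerD2l mulrCA ler_piMr ?exprn_ge0 ?(ltW q0) //.
  rewrite mulrC ler_pdivrMr ?exprn_gt0 // mul1r (le_trans (wser2_le _ _ _)) //.
  rewrite -!natrX ler_nat (leq_trans _ nT) // leq_exp2r // muln_gt0 //=.
  by rewrite ltnW // ltnW.
(* Bernoulli's bound is negative for [m > k], so extending it to all [m] only
   lowers the sum. *)
have E3 : k%:R ^+ r * \sum_(m < n.+1) (1 - r%:R / k%:R * m%:R) * e m <= (N F n k)%:R * r`!%:R.
  rewrite NE (widen (fun m => 'C(k - m + r, r)%:R * e m)).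
  rewrite [X in _ <= X * _]big_mkcond mulr_sumr mulr_suml.
  apply: ler_sum => m _; rewrite mulrA; case: ifP => [mk|/negbT].
    rewrite [leRHS]mulrAC; apply: ler_wpM2r => //.
    apply: (@le_trans _ _ ((k - m)%:R ^+ r)); last by rewrite -natrX -natrM ler_nat bin_lower.
    rewrite ltnS in mk; rewrite natrB //.
    have -> : k%:R - m%:R = k%:R * (1 - m%:R / k%:R) :> R by field; rewrite gt_eqF.
    rewrite exprMn ler_wpM2l ?exprn_ge0 ?(ltW k0) //.
    apply: le_trans (bernoulli_ineq _ _); first by rewrite -mulrA [_^-1 * _]mulrC.
    by rewrite divr_ge0 // ler_pdivrMr // mul1r ler_nat.
  rewrite -leqNgt => km; rewrite mul0r.
  rewrite mulr_le0_ge0 // mulr_ge0_le0 ?exprn_ge0 ?(ltW k0) // subr_le0.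
  rewrite mulrAC ler_pdivlMr // mul1r -natrM ler_nat.
  have r_gt0 : (0 < r)%N by move: q_gt2; case: q => [|[]].
  by apply: leq_trans (ltnW km) _; rewrite leq_pmull.
apply: le_trans E3; rewrite -mulrA ler_wpM2l ?exprn_ge0 ?(ltW k0) //.
under eq_bigr => m _ do rewrite mulrBl mul1r -(mulrA (r%:R / k%:R)).
rewrite sumrB E1 -mulr_sumr mulrBr lerD2l lerN2 mulrCA.
by rewrite ler_wpM2l // divr_ge0.
Qed.

Lemma Lcst_gt0 : 0 < Lcst.
Proof. exact: lim_Vprod_gt0. Qed.

Lemma acoef_asymptotics :
  acoef s * r`!%:R / (s%:R ^+ r * Lcst) @[s --> \oo] --> (1 : R).
Proof.
have L0 : Lcst != 0 by rewrite gt_eqF // Lcst_gt0.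
have h : (acoef s / 'C(s + r, r)%:R) * ('C(s + r, r)%:R * r`!%:R / s%:R ^+ r) / Lcst
    @[s --> \oo] --> Lcst * 1 / Lcst.
  apply: cvgM; last exact: cvg_cst.
  apply: cvgM; last exact: bin_asymptotics.
  by apply: wser1_asymptotics; exact: Vprod_cvg.
rewrite mulr1 mulfV // in h.
apply: cvg_trans h; apply: near_eq_cvg; near=> s.
have s0 : s%:R != 0 :> R by rewrite pnatr_eq0 -lt0n; near: s; exact: nbhs_infty_gt.
have b0 : 'C(s + r, r)%:R != 0 :> R by rewrite pnatr_eq0 -lt0n bin_gt0 leq_addl.
have sr0 : s%:R ^+ r != 0 :> R by rewrite expf_neq0.
rewrite /= -/(acoef s); move: (s%:R ^+ r) sr0 => t t0.
by field; rewrite L0 t0 b0.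
Unshelve. all: by end_near.
Qed.

(** Dividing by the main term separates variables: [alpha] depends only on [n - k] and [beta] only
    on [k], so uniformity reduces to two limits in one variable. *)
Lemma ratio_bounds n k T : (0 < k)%N -> (k < n)%N -> (n.+1 ^ (6 * q) <= 2 ^ T)%N ->
  let alpha := acoef (n - k) * r`!%:R / ((n - k)%:R ^+ r * Lcst) in
  let beta := 'C(k + r, r)%:R * r`!%:R / k%:R ^+ r in
  let ratio := (N F n k)%:R / main_term R F n k in
  ratio <= alpha * beta /\
  alpha * (1 - r%:R * T%:R / k%:R) - r%:R * r`!%:R / (Lcst * k%:R) <= ratio.
Proof.
move=> k_gt0 kn nT alpha beta ratio.
have [up lo] := N_bounds k_gt0 (ltnW kn) nT.
have k0 : 0 < k%:R :> R by rewrite ltr0n.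
have s1 : 1 <= (n - k)%:R :> R by rewrite ler1n subn_gt0.
have s0 := lt_le_trans ltr01 s1.
have q0 : 0 < q%:R :> R by rewrite ltr0n ltnW // ltnW.
have L0 := Lcst_gt0.
have f0 : 0 < r`!%:R :> R by rewrite ltr0n fact_gt0.
have main_eq : main_term R F n k =
    q%:R ^+ (n - k) * k%:R ^+ r * (n - k)%:R ^+ r * Lcst / r`!%:R ^+ 2.
  rewrite /main_term CqE -/Lcst -natrB ?(ltnW kn) //.
  rewrite -{1}(subnK (ltnW kn)) exprD; have qk0 : q%:R ^+ k != 0 :> R by rewrite expf_neq0 ?gt_eqF.
  move: (q%:R ^+ k) qk0 (q%:R ^+ (n - k)) (k%:R ^+ r) ((n - k)%:R ^+ r) => x x0 y z t.
  by field; rewrite x0 gt_eqF.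
have main_gt0 : 0 < main_term R F n k.
  rewrite main_eq; apply: divr_gt0; last exact: exprn_gt0.
  by apply: mulr_gt0 => //; rewrite !mulr_gt0 ?exprn_gt0.
have kr0 : 0 < k%:R ^+ r :> R by rewrite exprn_gt0.
have sr1 : 1 <= (n - k)%:R ^+ r :> R by rewrite exprn_ege1.
have Q0 : 0 < q%:R ^+ (n - k) :> R by rewrite exprn_gt0.
rewrite /alpha /beta /ratio {alpha beta ratio}; split.
  rewrite ler_pdivrMr // (le_trans up) // main_eq le_eqVlt; apply/orP; left; apply/eqP.
  move: (k%:R ^+ r) kr0 ((n - k)%:R ^+ r) sr1 (q%:R ^+ (n - k)) Q0 (acoef _) => x x0 y y1 z z0 a.
  by field; rewrite !gt_eqF // (lt_le_trans _ y1).
rewrite ler_pdivlMr // -(ler_pM2r f0); apply: le_trans lo; rewrite main_eq.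
move: (k%:R ^+ r) kr0 ((n - k)%:R ^+ r) sr1 (q%:R ^+ (n - k)) Q0 (acoef _) => x x0 y y1 z z0 a.
move: (r%:R : R) (T%:R : R) (ler0n R r) => rr t rr0.
have y0 : 0 < y by apply: lt_le_trans y1.
have -> : (a * r`!%:R / (y * Lcst) * (1 - rr * t / k%:R) - rr * r`!%:R / (Lcst * k%:R)) *
    (z * x * y * Lcst / r`!%:R ^+ 2) * r`!%:R =
    x * z * (a * (1 - rr * t / k%:R)) - x * z * (rr / k%:R) * y.
  by field; rewrite !gt_eqF.
have -> : x * z * (a - rr / k%:R * (t * a + 1)) =
    x * z * (a * (1 - rr * t / k%:R)) - x * z * (rr / k%:R).
  by field; rewrite gt_eqF.
(* The factor [1 / (n - k) ^ r], at most 1, is dropped from the error, which then depends on [k]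
   alone. *)
by rewrite lerD2l lerN2 ler_peMr // !mulr_ge0 ?invr_ge0 // ltW.
Qed.

(** [2 ^ (trunc_log 2 n + 1)] is at least [n + 1]; the assumption [1 <= ln n] absorbs the
    rounding. *)
Lemma tilt_exponent n : 1 <= ln n%:R :> R -> exists2 T : nat,
  (n.+1 ^ (6 * q) <= 2 ^ T)%N & T%:R <= (6 * q)%:R * (1 + (ln 2)^-1) * ln n%:R :> R.
Proof.
move=> ln1.
have n_gt0 : (0 < n)%N by case: n ln1 => // /(lt_le_trans ltr01); rewrite ln0 ?ltxx.
have /andP[lo hi] := trunc_log_bounds (isT : 1 < 2)%N n_gt0.
exists ((trunc_log 2 n).+1 * (6 * q))%N.
  by rewrite [leqRHS]expnM leq_exp2r // muln_gt0 /= ltnW // ltnW.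
have ln2 : 0 < ln 2 :> R by rewrite ln_gt0 // ltr1n.
rewrite natrM mulrC -mulrA ler_wpM2l // mulrDl mul1r -natr1 addrC lerD //.
rewrite mulrC ler_pdivlMr // mulr_natl -lnXn // -natrX ler_ln ?posrE ?ltr0n ?expn_gt0 //.
by rewrite ler_nat.
Qed.

(** As [d * d <= d], one has [(1 + d)^2 <= 1 + 3 d] and [(1 - d)^2 - d >= 1 - 3 d], hence the choice
    [eps / 3]. *)
Lemma ratio_squeeze (d eps al be x y rat : R) : 0 < d -> d <= 1 -> d <= eps / 3 ->
  `|1 - al| <= d -> `|1 - be| <= d -> 0 <= x -> x <= d -> y <= d ->
  rat <= al * be -> al * (1 - x) - y <= rat -> `|rat - 1| <= eps.
Proof.
move=> d0 d1 d_eps; rewrite !ler_distl => /andP[a1 a2] /andP[b1 b2] x0 x1 y1 up lo.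
have dd : d * d <= d by rewrite ler_piMr // ltW.
have dd0 : 0 <= d * d by rewrite mulr_ge0 // ltW.
have lo' : (1 - d) * (1 - d) <= al * (1 - x) by apply: ler_pM; lra.
have up' : al * be <= (1 + d) * (1 + d) by apply: ler_pM; lra.
by apply/andP; split; lra.
Qed.

Lemma half_range m k n : (0 < k)%N -> (k.*2 <= n)%N -> (m.*2 < n)%N ->
  (k < n)%N /\ (m <= n - k)%N.
Proof. lia. Qed.

Lemma ratio_uniform (B : R) (xi : nat -> R) (eps : R) : 2 <= B ->
  xi n @[n --> \oo] --> +oo -> 0 < eps ->
  \forall n \near \oo, forall k, k_range B xi n k ->
    `|(N F n k)%:R / main_term R F n k - 1| <= eps.
Proof.
move=> B2 xiy eps0.
have L0 := Lcst_gt0.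
pose d : R := Num.min (eps / 3) 1.
have d0 : 0 < d by rewrite lt_min divr_gt0 //= ltr01.
have [d_eps d1] : d <= eps / 3 /\ d <= 1 by apply/andP; rewrite -le_min.
have /cvgrPdist_le /(_ _ d0) [S0 _ hS] := acoef_asymptotics.
have /cvgrPdist_le /(_ _ d0) [K0 _ hK] := @bin_asymptotics R r.
pose C : R := (6 * q)%:R * (1 + (ln 2)^-1).
have ln2 : 0 < ln 2 :> R by rewrite ln_gt0 // ltr1n.
have C0 : 0 <= C by rewrite mulr_ge0 // addr_ge0 ?invr_ge0 // ltW.
(* A sum of all thresholds for [k]: [K0] for the binomial limit, the last two terms for the errors.
   The first error needs [k >= M * ln n], as [T <= C * ln n]; any [xi] tending to infinity
   eventually exceeds [M]. *)
pose M : R := 1 + K0%:R + r%:R * C / d + r%:R * r`!%:R / (Lcst * d).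
have t3 : 0 <= r%:R * C / d by apply: divr_ge0; [exact: mulr_ge0 | exact: ltW].
have t4 : 0 <= r%:R * r`!%:R / (Lcst * d).
  by apply: divr_ge0; [exact: mulr_ge0 | apply/ltW/mulr_gt0].
have [M1 MK MC MF] : [/\ 1 <= M, K0%:R <= M, r%:R * C / d <= M &
    r%:R * r`!%:R / (Lcst * d) <= M].
  move: (ler0n R K0) t3 t4; rewrite /M.
  by move: (K0%:R) (r%:R * C / d) (_ / (Lcst * d)) => x y z x0 y0 z0; split; lra.
have /cvgryPge /(_ M) hxi := xiy.
move: M M1 MK MC MF hxi {t3 t4} => M M1 MK MC MF hxi.
near=> n => k /andP[klo khi].
have ln1 : 1 <= ln n%:R :> R.
  have n0 : 0 < n%:R :> R by rewrite ltr0n; near: n; exact: nbhs_infty_gt.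
  have : expR 1 <= n%:R :> R by near: n; exact: nbhs_infty_ger.
  by rewrite -ler_ln ?posrE ?expR_gt0 // expRK.
have nS : (S0.*2.+1 <= n)%N by near: n; exact: nbhs_infty_ge.
have xiM : M <= xi n by near: n.
have kM : M * ln n%:R <= k%:R by apply: le_trans klo; rewrite ler_wpM2r // (le_trans ler01).
have Mk : M <= k%:R by apply: le_trans kM; rewrite ler_peMr // (le_trans ler01).
have k0 : 0 < k%:R :> R by apply: lt_le_trans Mk; apply: lt_le_trans M1.
have k_gt0 : (0 < k)%N by rewrite -(ltr0n R).
(* [B >= 2] leaves [n - k >= n / 2], past [S0] for all [k] in the range at once. *)
have k2n : (k.*2 <= n)%N.
  rewrite -muln2 -(ler_nat R) natrM; move: khi; rewrite ler_pdivlMr; last by lra.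
  by apply: le_trans; rewrite ler_wpM2l.
have [kn Snk] := half_range k_gt0 k2n nS.
have [T nT TC] := tilt_exponent ln1; rewrite -/C in TC.
have [up lo] := ratio_bounds k_gt0 kn nT.
have hs : `|1 - acoef (n - k) * r`!%:R / ((n - k)%:R ^+ r * Lcst)| <= d by exact: hS.
have hk : `|1 - 'C(k + r, r)%:R * r`!%:R / k%:R ^+ r| <= d.
  by apply: hK => /=; rewrite -(ler_nat R) (le_trans MK).
have e1 : r%:R * T%:R / k%:R <= d.
  rewrite ler_pdivrMr //.
  apply: (@le_trans _ _ (d * (M * ln n%:R))); last by rewrite ler_wpM2l // ltW.
  apply: (@le_trans _ _ (r%:R * (C * ln n%:R))); first by rewrite ler_wpM2l.
  by rewrite (mulrA r%:R C) (mulrA d M) ler_wpM2r ?(le_trans ler01 ln1) // [leRHS]mulrC -ler_pdivrMr //.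
have e1_ge0 : 0 <= r%:R * T%:R / k%:R :> R by apply: divr_ge0; [exact: mulr_ge0 | exact: ltW].
have e2 : r%:R * r`!%:R / (Lcst * k%:R) <= d.
  rewrite (ler_pdivrMr _ _ (mulr_gt0 L0 k0)).
  rewrite (_ : d * (Lcst * k%:R) = k%:R * (Lcst * d)); last by ring.
  rewrite -(ler_pdivrMr _ _ (mulr_gt0 L0 d0)).
  exact: le_trans Mk.
exact: (ratio_squeeze d0 d1 d_eps hs hk e1_ge0 e1 e2 up lo).
Unshelve. all: by end_near.
Qed.

End Final.

Theorem theorem1p2 (R : realType) (F : finFieldType) (B : R) (xi : nat -> R)
    (hq : (2 < #|F|)%N)
    (hB : 2 <= B)
    (hxi : xi n @[n --> \oo] --> +oo)
    (hslow : \forall n \near \oo, k_range B xi n !=set0) :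
  [/\ cvg (partial_euler_product R (F := F) @ totally),
      forall F' : finFieldType, #|F'| = #|F| -> Cq R F' = Cq R F
    & max_rel_error F B xi n @[n --> \oo] --> (0 : R)].
Proof.
split.
- exact: cvgP (@partial_euler_product_cvg R F).
- exact: eq_Cq.
apply/cvgr0Pnorm_le => eps eps0.
near=> n.
have unif : forall k, k_range B xi n k -> `|(N F n k)%:R / main_term R F n k - 1| <= eps.
  by near: n; exact: ratio_uniform.
(* A member of the range serves twice: for bounding the supremum of a nonempty set, and for its
   nonnegativity. *)
have [k0 k0n] : k_range B xi n !=set0 by near: n.
have ub : ubound [set `|(N F n k)%:R / main_term R F n k - 1| | k in k_range B xi n] eps.
  by move=> _ [k kn <-]; exact: unif.
rewrite ger0_norm /max_rel_error.
  by apply: ge_sup => //; exists `|(N F n k0)%:R / main_term R F n k0 - 1|, k0.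
apply: (@le_trans _ _ `|(N F n k0)%:R / main_term R F n k0 - 1|) => //.
by apply: ub_le_sup; [exists eps | exists k0].
Unshelve. all: by end_near.
Qed.
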